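(* Consider grant-free transmission (see context) with $N=1$ time slot per frame, $M$ users, transmit SNR $P$, slot duration $T>0$ and target rate $R>0$, using either OMA or NOMA with $K=2$ receive SNR levels. For fixed $M$, let $\bar\Delta^N$ and $\bar\Delta^O$ denote the high-SNR ($P\to\infty$) limits of the average AoI of user ${\rm U}_1$ achieved by NOMA and OMA, respectively, each with its optimal (AoI-minimizing) transmission attempt probability $\mathbb{P}_{\rm TX}\in(0,1]$. Then, as $M\to\infty$, $$\frac{\bar\Delta^N}{\bar\Delta^O}\to\frac{2e^{\eta-1}}{\eta\left(e^{\frac{\eta}{2}}+1+\frac{\eta}{2}\right)},$$ where $\eta$ is the (unique) positive root of $\left(1-\frac{\eta}{2}\right)e^{-\frac{\eta}{2}}+\left(1-\frac{\eta^2}{2}\right)e^{-\eta}=0$.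
   Context: Model. $M$ users ${\rm U}_1,\dots,{\rm U}_M$ communicate with one base station. Time is divided into frames of $N$ slots, each slot of duration $T$; here $N=1$, so each frame is one slot. At the beginning of each frame every user generates a new update (generate-at-request) and tries to deliver it in that frame; since $N=1$, all $M$ users contend in every slot. In each slot each user independently makes a transmission attempt with probability $\mathbb{P}_{\rm TX}$ (independently across slots). A successful update is received at the end of the slot in which it is transmitted. Channel gains $h$ are i.i.d. (across users and slots) complex Gaussian with zero mean and unit variance; noise power is normalized to one. OMA (slotted ALOHA). A user's update succeeds in a slot if and only if the user transmits, no other user transmits in that slot, and no outage occurs, i.e. $\log_2(1+P|h|^2)>R$; the no-outage probability is $e^{-(2^R-1)/P}$, which tends to $1$ as $P\to\infty$. NOMA-assisted random access with $K=2$ levels. The base station preconfigures receive SNR levels $P_2=2^R-1$ and $P_1=(2^R-1)(1+(M-1)P_2)$, independent of the transmit power budget (transmit SNR) $P$. In each slot each user independently chooses one of the two levels with probability $1/2$ each. Level $P_k$ is infeasible for a user with channel gain $h$ if $P_k/|h|^2>P$, and the user's update then fails. (Whether such a user still interferes with others is immaterial, because only the limit $P\to\infty$ is considered, in which every level is feasible with probability tending to one.) The base station performs successive interference cancellation (SIC), processing level $P_1$ and then $P_2$. If exactly one user transmits at a level (with the level feasible), and SIC has not been terminated earlier, that user succeeds. If two or more users transmit at the same level, a collision occurs, all of them fail and SIC terminates, so a collision at $P_1$ makes all users at $P_2$ fail too. If no user transmits at $P_1$, SIC proceeds to $P_2$. Age of information (AoI). The instantaneous AoI of ${\rm U}_1$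 at time $t$ is $\Delta(t)=t-T(t)$, where $T(t)$ is the generation time of ${\rm U}_1$'s freshest update successfully delivered to the base station by time $t$. The average AoI is $\bar\Delta=\lim_{T_\Delta\to\infty}\frac{1}{T_\Delta}\int_0^{T_\Delta}\Delta(t)\,dt$. Equivalently, $\bar\Delta=\frac{\mathcal{E}\{S_{j-1}Y_j\}}{\mathcal{E}\{Y_j\}}+\frac{\mathcal{E}\{Y_j^2\}}{2\mathcal{E}\{Y_j\}}$, where $S_j$ is the time between generation and reception of the $j$-th successful update of ${\rm U}_1$ and $Y_j$ is the time between the receptions of its $(j-1)$-th and $j$-th successful updates. *)

(* Defs.v *)
(* MathComp-Analysis *)
From mathcomp Require Export all_boot all_order all_algebra finmap.
From mathcomp Require Export all_classical all_reals all_analysis.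

Set Implicit Arguments.
Unset Strict Implicit.
Unset Printing Implicit Defensive.

Import Order.TTheory GRing.Theory Num.Theory.
Import numFieldNormedType.Exports.

Local Open Scope classical_set_scope.
Local Open Scope ring_scope.

Definition mutually_independent d (Omega : measurableType d) d'
    (S : measurableType d') (R : realType) (Pr : probability Omega R)
    (I : choiceType) (X : I -> {RV Pr >-> S}) : Prop :=
  forall (J : {fset I}) (A : I -> set S), (forall i, measurable (A i)) ->
    Pr (\bigcap_(i in [set` J]) (X i @^-1` A i)) =
    (\prod_(i <- J) Pr (X i @^-1` A i))%E.

(* What one user draws in one slot: whether it attempts, which level it chooses
   (true is P_1, the level decoded first; false is P_2), and the real and
   imaginary parts of its channel gain.  Under OMA the level is ignored. *)
Notation draw R := (bool * bool * (measurableTypeR R * measurableTypeR R))%type.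

Definition attempts (R : realType) (x : draw R) : bool := x.1.1.
Definition level (R : realType) (x : draw R) : bool := x.1.2.
Definition gain2 (R : realType) (x : draw R) : R :=
  (x.2.1 : R) ^+ 2 + (x.2.2 : R) ^+ 2.

(* A zero-mean unit-variance complex Gaussian has independent real and imaginary
   parts, each centred normal with variance 1/2; the second parameter of
   normal_prob is the standard deviation. *)
Definition draw_law (R : realType) (p : R) : probability (draw R) R :=
  ((bernoulli_prob p \x bernoulli_prob (2^-1 : R)) \x
   (normal_prob 0 (Num.sqrt 2^-1) \x normal_prob 0 (Num.sqrt 2^-1)))%E.

(* The draws of M users over the slots 0, 1, 2, ...  This is inhabited for every
   real p, since bernoulli_prob p is the Dirac mass at false when p is outside
   [0, 1]; only 0 < p <= 1 is used. *)
Record access_model (R : realType) (M : nat) (p : R) := AccessModel {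
  model_disp : measure_display;
  outcome : measurableType model_disp;
  Pr : probability outcome R;
  draws : 'I_M * nat -> {RV Pr >-> draw R};
  draws_law : forall i A, measurable A ->
    distribution Pr (draws i) A = draw_law p A;
  draws_indep : mutually_independent draws
}.

Variant scheme := OMA | NOMA.

Section slot.
Variables (R : realType) (M : nat) (P rate : R).

Definition oma_success (x : 'I_M -> draw R) (u : 'I_M) : bool :=
  [&& attempts (x u), [forall v, (v != u) ==> ~~ attempts (x v)]
    & rate < ln (1 + P * gain2 (x u)) / ln 2].

Definition snr_level (first : bool) : R :=
  let P2 := 2 `^ rate - 1 in
  if first then (2 `^ rate - 1) * (1 + (M%:R - 1) * P2) else P2.

(* Feasibility P_k / |h|^2 <= P is written without division, so that h = 0 is
   infeasible.  A user whose chosen level is infeasible stays silent. *)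
Definition transmits_at (first : bool) (x : draw R) : bool :=
  [&& attempts x, level x == first & snr_level first <= P * gain2 x].

Definition load (x : 'I_M -> draw R) (first : bool) : nat :=
  #|[pred v | transmits_at first (x v)]|.

Definition noma_success (x : 'I_M -> draw R) (u : 'I_M) : bool :=
  (transmits_at true (x u) && (load x true == 1)%N) ||
  [&& transmits_at false (x u), (load x false == 1)%N & (load x true <= 1)%N].

Definition success (s : scheme) : ('I_M -> draw R) -> 'I_M -> bool :=
  match s with OMA => oma_success | NOMA => noma_success end.

End slot.

Section aoi.
Variables (R : realType) (M : nat) (s : scheme) (T rate P p : R).
Variables (X : access_model M p) (u : 'I_M).

Definition delivered (n : nat) (w : outcome X) : bool :=
  success P rate s (fun v => draws X (v, n) w) u.

(* Slot n is [n T, (n + 1) T]: its update is generated at its start and received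
   at its end.  Before the first delivery the AoI is counted from time 0; this
   does not affect the time average. *)
Definition freshest (t : R) (w : outcome X) : R :=
  sup [set g : R | g = 0 \/
    exists n, [/\ delivered n w, n.+1%:R * T <= t & g = n%:R * T]].

Definition aoi (t : R) (w : outcome X) : R := t - freshest t w.

(* The time average converges to the constant a almost surely; a = +oo is
   possible, e.g. under OMA with p = 1 and at least two users. *)
Definition average_aoi (a : \bar R) : Prop :=
  \forall w \ae Pr X,
    (tau^-1 * \int[lebesgue_measure]_(t in `[0, tau]) aoi t w)%:E
      @[tau --> +oo%R] --> a.

End aoi.

(* a is the limit, as P tends to infinity, of the average AoI of user u when,
   for each P, the attempt probability minimizes the average AoI over (0, 1]. *)
Definition high_snr_optimal_aoi (R : realType) (M : nat) (s : scheme)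
    (T rate : R) (X : forall p : R, access_model M p) (u : 'I_M) (a : R) : Prop :=
  exists (A : R -> R -> \bar R) (popt : R -> R),
  [/\ forall P p, 0 < P -> 0 < p <= 1 ->
        average_aoi s T rate P (X p) u (A P p),
      forall P, 0 < P -> 0 < popt P <= 1 /\
        (forall p, 0 < p <= 1 -> (A P (popt P) <= A P p)%E)
    & A P (popt P) @[P --> +oo%R] --> a%:E].

(* Main.v *)
(* With success probability q per slot, the age process jumps to 1 on success
   and increases by 1 otherwise.  The sum S_n of the ages before slot n differs
   from n / q by a martingale and a bounded-in-L^2 correction, so
   E (S_n - n / q)^2 = O(n); Chebyshev and Borel-Cantelli along the squares,
   together with the monotonicity of S_n, give S_n / n -> 1 / q almost surely,
   hence average AoI T (1 / q + 1 / 2).  As P tends to infinity q converges,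
   uniformly in p, to p (1 - p)^m for OMA and to
   p/2 (1 - p/2)^m + p/2 (1 - p)^m + m (p/2)^2 (1 - p)^(m - 1) for NOMA, where
   m is the number of competitors, so the optima converge to the maxima over p.
   With x = m p, m times these polynomials tend to x e^(-x), with maximum 1/e,
   and to phi(x) = x/2 (e^(-x/2) + e^(-x) (1 + x/2)).  The derivative of phi is
   e^(-x) times a strictly decreasing function vanishing at eta, so the maximum
   is phi(eta) and the ratio tends to e^(-1) / phi(eta). *)
Require Import Defs.
From mathcomp Require Import measurable_realfun ring lra zify.

Set Implicit Arguments.
Unset Strict Implicit.
Unset Printing Implicit Defensive.

Import Order.TTheory GRing.Theory Num.Theory.
Import numFieldNormedType.Exports.

Local Open Scope classical_set_scope.
Local Open Scope ring_scope.

(** * The age process driven by independent bits *)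

(** All probability is reduced to finite sums. The outcome space is arbitrary and a draw contains
    continuous gains, so each draw is projected to a finite symbol that already decides success.
    Independence then makes the probability of any event about finitely many slots a finite sum of
    products, and the success bits are i.i.d. in the concrete sense that their cylinder
    probabilities factor. Expectations over the bits are the recursion [bit_expect], under which the
    martingale estimate is an algebraic one-step inequality, with no filtration or conditional
    expectation. The optimal p is never computed, neither for finite P nor for finite M. At finite
    P, compactness of [0, 1] provides a maximizer and uniform closeness to the infinite-SNR
    polynomial controls its value. At finite M, that value is squeezed between a bound valid for
    every p and the value at one explicit p. *)

Fixpoint bit_expect (R : realType) (q : R) (n : nat) (f : seq bool -> R) : R :=
  if n is n'.+1 then
    bit_expect q n' (fun b => q * f (true :: b) + (1 - q) * f (false :: b))
  else f [::].

Lemma le_bit_expect (R : realType) (q : R) n (f g : seq bool -> R) :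
  0 <= q <= 1 -> (forall b, size b = n -> f b <= g b) ->
  bit_expect q n f <= bit_expect q n g.
Proof.
move=> /andP[q0 q1]; elim: n f g => [|n IH] f g fg /=; first exact: fg.
apply: IH => b bn; apply: lerD; apply: ler_wpM2l; rewrite ?subr_ge0//;
  by apply: fg; rewrite /= bn.
Qed.

Lemma bit_expectD (R : realType) (q : R) n (f g : seq bool -> R) :
  bit_expect q n (fun b => f b + g b) = bit_expect q n f + bit_expect q n g.
Proof.
elim: n f g => [//|n IH] f g /=; rewrite -IH; congr bit_expect.
by apply/funext => b; ring.
Qed.

Lemma bit_expectZ (R : realType) (q c : R) n (f : seq bool -> R) :
  bit_expect q n (fun b => c * f b) = c * bit_expect q n f.
Proof.
elim: n f => [//|n IH] f /=; rewrite -IH; congr bit_expect.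
by apply/funext => b; ring.
Qed.

Lemma bit_expect_cst (R : realType) (q c : R) n :
  bit_expect q n (fun=> c) = c.
Proof.
elim: n => [//|n IH] /=; rewrite -[RHS]IH; congr bit_expect.
by apply/funext => b; ring.
Qed.

Fixpoint age (b : seq bool) : nat :=
  if b is x :: b' then (if x then 1 else (age b').+1)%N else 0%N.

(** Each slot contributes the age at its start, so the outcome of the last slot, the head of the
    list, does not enter. The empty history has age 0 because the AoI is counted from time 0. *)
Fixpoint age_sum (b : seq bool) : nat :=
  if b is _ :: b' then (age b' + age_sum b')%N else 0%N.

(** The newest slot comes first: advancing by one slot is a cons, and [bit_expect] averages over the
    latest bit first, which plays the part of conditioning on the past. *)
Fixpoint history (B : nat -> bool) (n : nat) : seq bool :=
  if n is n'.+1 then B n' :: history B n' else [::].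

Section second_moment.
Variables (R : realType) (q : R).
Hypothesis q01 : 0 < q <= 1.

(* [age_sum b - size b / q + age b / q] is a martingale; the other two terms
   make up for the growth of its square. *)
Let lyapunov (b : seq bool) : R :=
  ((age_sum b)%:R - (size b)%:R / q + (age b)%:R / q) ^+ 2 +
  (age b)%:R ^+ 2 / q ^+ 2 + 2 * (age b)%:R / q ^+ 3.

(** The martingale increment has conditional variance a^2 (1 - q) / q, unbounded in the age a. The
    drift of a^2 / q^2 overcomes this, and that of 2 a / q^3 outweighs the linear term it
    creates. *)
Let lyapunov_step b :
  q * lyapunov (true :: b) + (1 - q) * lyapunov (false :: b) <=
  lyapunov b + (q ^- 2 + 2 * q ^- 3).
Proof.
have q0 : q != 0 by case/andP: q01 => q0 _; rewrite gt_eqF.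
rewrite /lyapunov /= !natrD -!(natr1 (size b)) -!(natr1 (age b)).
move: (age_sum b)%:R (size b)%:R (ler0n R (age b)) => S n.
move: (age b)%:R => a a0.
rewrite -subr_ge0; set x := (X in 0 <= X).
have -> : x = a ^+ 2 + 2 * a / q.
  by rewrite /x; field.
case/andP: q01 => qgt0 _.
by rewrite addr_ge0// ?sqr_ge0// divr_ge0// ?mulr_ge0// ltW.
Qed.

Lemma age_sum_second_moment n :
  bit_expect q n (fun b => ((age_sum b)%:R - n%:R / q) ^+ 2) <=
  2 * (q ^- 2 + 2 * q ^- 3) * n%:R.
Proof.
have q0 : q != 0 by case/andP: q01 => q0 _; rewrite gt_eqF.
have qge0 : 0 <= q <= 1 by case/andP: q01 => /ltW-> ->.
have H : bit_expect q n lyapunov <= (q ^- 2 + 2 * q ^- 3) * n%:R.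
  elim: n => [|n IH] /=.
    rewrite /lyapunov /= !mul0r mulr0 mul0r expr0n !(subr0, addr0).
    by rewrite expr0n/= mul0r mulr0 addr0.
  apply: (@le_trans _ _ (bit_expect q n (fun b => lyapunov b + (q ^- 2 + 2 * q ^- 3)))).
    by apply: le_bit_expect => // b _; exact: lyapunov_step.
  by rewrite bit_expectD bit_expect_cst -(natr1 n) mulrDr mulr1 lerD2r.
rewrite -mulrA; apply: (le_trans _ (ler_wpM2l (ler0n _ 2) H)).
rewrite -bit_expectZ; apply: le_bit_expect => // b <-.
rewrite /lyapunov; move: (age_sum b)%:R (size b)%:R (ler0n R (age b)) => S m.
move: (age b)%:R => a a0.
set u := _ - _; have -> : a ^+ 2 / q ^+ 2 = (a / q) ^+ 2 by field.
have h : 0 <= 2 * a / q ^+ 3.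
  by case/andP: q01 => ? _; rewrite divr_ge0 ?mulr_ge0 ?exprn_ge0// ltW.
move: (a / q) (2 * a / q ^+ 3) h => v w h.
(* The slack in u^2 <= 2 ((u + v)^2 + v^2 + h) is (u + 2 v)^2 + 2 h; hence the factor 2 in the
   statement. *)
have := sqr_ge0 (u + 2 * v); rewrite !expr2; nra.
Qed.

End second_moment.

(** * The AoI integral of a deterministic delivery pattern *)

(** n - a is the slot in which the freshest update was generated. When nothing has been delivered, a
    = n, and n - a = 0 agrees with counting from time 0. *)
Lemma age_history_last B n (a := age (history B n)) :
  [/\ (a <= n)%N, forall k, (k < n)%N -> B k -> (k <= n - a)%N
    & a = n \/ (a != 0%N /\ B (n - a)%N)].
Proof.
rewrite {}/a; elim: n => [|n [IH1 IH2 IH3]] /=; first by split => //; left.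
case: ifPn => Bn; split => //.
- by move=> k; lia.
- by right; rewrite subn1.
- by move=> k; rewrite ltnS leq_eqVlt => /predU1P[->|/IH2 //]; rewrite (negbTE Bn).
- case: IH3 => [->|[a0 Ba]]; first by left.
  by right; split => //; rewrite subSS.
Qed.

Lemma integrable_setU d (S : measurableType d) (R : realType)
    (mu : {measure set S -> \bar R}) (A B : set S) (f : S -> \bar R) :
  measurable A -> measurable B -> [disjoint A & B] ->
  mu.-integrable A f -> mu.-integrable B f -> mu.-integrable (A `|` B) f.
Proof.
move=> mA mB AB /integrableP[mfA fA] /integrableP[mfB fB].
have mf := (measurable_funU _ mA mB).2 (conj mfA mfB).
apply/integrableP; split => //.
rewrite ge0_integral_setU//; first exact: lte_add_pinfty.
exact: measurableT_comp.
Qed.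

(** Almost sure convergence is available only along tau = k^2 T. Consecutive squares have ratio
    tending to 1, so a nondecreasing integral cannot deviate in between. [K tau] is the k with k^2 T
    <= tau < (k + 1)^2 T. *)
Lemma square_interpolation (R : realType) (T l : R) (I : R -> R) : 0 < T ->
  {in Num.nneg &, {homo I : x y / x <= y}} -> 0 <= I 0 ->
  (k.+1%:R ^+ 2 * T)^-1 * I (k.+1%:R ^+ 2 * T) @[k --> \oo] --> l ->
  tau^-1 * I tau @[tau --> +oo] --> l.
Proof.
move=> T0 Imono I0 ul.
pose u k := (k%:R ^+ 2 * T)^-1 * I (k%:R ^+ 2 * T).
have {}ul : u @ \oo --> l by rewrite -(cvg_shiftS u).
pose r k : R := (k%:R / k.+1%:R) ^+ 2.
have r1 : r @ \oo --> (1 : R).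
  have h : (fun k => 1 - @harmonic R k) @ \oo --> (1 - 0 : R).
    by apply: cvgB; [exact: cvg_cst|exact: cvg_harmonic].
  rewrite subr0 in h; rewrite -[X in _ --> X]mulr1.
  rewrite (_ : r = (fun k => 1 - @harmonic R k) \* (fun k => 1 - @harmonic R k)).
    exact: cvgM.
  apply/funext => k; rewrite /r /harmonic /=.
  by rewrite -natr1; field; rewrite (natr1 k) pnatr_eq0.
pose K (tau : R) := Num.truncn (Num.sqrt (tau / T)).
have Koo : K @ +oo --> \oo.
  apply/cvgnyPge => A; near=> tau.
  have AT : A%:R ^+ 2 * T <= tau by near: tau; apply: nbhs_pinfty_ge; exact: num_real.
  rewrite /K truncn_ge_nat ?sqrtr_ge0// -(@ger0_norm _ A%:R)// -sqrtr_sqr.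
  by rewrite ler_wsqrtr// ler_pdivlMr.
have low : u (K tau) * r (K tau) @[tau --> +oo] --> l.
  rewrite -[l]mulr1; apply: cvgM.
    exact: (cvg_comp K u Koo ul).
  exact: (cvg_comp K r Koo r1).
have upp : u (K tau).+1 / r (K tau) @[tau --> +oo] --> l.
  rewrite -[l]divr1; apply: cvgM.
    apply: (cvg_comp K (fun k => u k.+1) Koo); by rewrite (cvg_shiftS u).
  apply: cvgV; first exact: oner_neq0.
  exact: (cvg_comp K r Koo r1).
apply: (squeeze_cvgr _ low upp); near=> tau.
have tauT : T <= tau by near: tau; apply: nbhs_pinfty_ge; exact: num_real.
have tau0 : 0 < tau by exact: lt_le_trans tauT.
have K0 : (0 < K tau)%N.
  by rewrite /K truncn_gt0 -sqrtr1 ler_sqrt ?ler_pdivlMr ?mul1r// divr_ge0// ltW.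
have Kle : (K tau)%:R ^+ 2 * T <= tau.
  rewrite -ler_pdivlMr// -[leRHS]sqr_sqrtr; last by rewrite divr_ge0// ltW.
  by rewrite ler_sqr ?nnegrE ?sqrtr_ge0 ?ler0n// truncn_le sqrtr_ge0.
have Kgt : tau <= (K tau).+1%:R ^+ 2 * T.
  rewrite -ler_pdivrMr// -[leLHS]sqr_sqrtr; last by rewrite divr_ge0// ltW.
  by rewrite ler_sqr ?nnegrE ?sqrtr_ge0 ?ler0n// ltW// -truncn_le_nat.
move: (K tau) K0 Kle Kgt => k k0 kle kgt.
have k0' : (0 : R) < k%:R by rewrite ltr0n.
have kT0 : 0 < k%:R ^+ 2 * T by rewrite mulr_gt0// exprn_gt0.
have kT1 : 0 < k.+1%:R ^+ 2 * T by rewrite mulr_gt0// exprn_gt0.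
have I1 : I (k%:R ^+ 2 * T) <= I tau by apply: Imono => //; rewrite nnegrE ltW.
have I2 : I tau <= I (k.+1%:R ^+ 2 * T) by apply: Imono => //; rewrite nnegrE ltW.
have Ige0 x : 0 <= x -> 0 <= I x.
  by move=> x0; apply: le_trans I0 _; apply: Imono; rewrite ?nnegrE.
have -> : u k * r k = I (k%:R ^+ 2 * T) / (k.+1%:R ^+ 2 * T).
  by rewrite /u /r; field; rewrite !gt_eqF.
have -> : u k.+1 / r k = I (k.+1%:R ^+ 2 * T) / (k%:R ^+ 2 * T).
  by rewrite /u /r; field; rewrite !gt_eqF.
rewrite [_^-1 * _]mulrC; apply/andP; split.
- by apply: ler_pM => //; rewrite ?Ige0 ?invr_ge0 ?lef_pV2 ?posrE// ltW.
- by apply: ler_pM => //; rewrite ?Ige0 ?invr_ge0 ?lef_pV2 ?posrE// ltW.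
Unshelve. all: by end_near. Qed.

Section deterministic_age.
Variables (R : realType) (T : R) (B : nat -> bool).
Hypothesis T_gt0 : 0 < T.

Let last_generation (t : R) : R := sup [set g : R | g = 0 \/
  exists n, [/\ B n, n.+1%:R * T <= t & g = n%:R * T]].

Lemma last_generationE n t : n%:R * T <= t < n.+1%:R * T ->
  last_generation t = (n - age (history B n))%:R * T.
Proof.
move=> /andP[nt tn]; have [h1 h2 h3] := age_history_last B n.
set l := (n - _)%N in h2 h3 *.
apply/eqP; rewrite eq_le; apply/andP; split.
- apply: ge_sup; first by exists 0; left.
  move=> g [->|[k [Bk kt ->]]]; first by rewrite mulr_ge0// ltW.
  rewrite ler_pM2r// ler_nat h2//.
  have := le_lt_trans kt tn; rewrite ltr_pM2r// ltr_nat; lia.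
- apply: ub_le_sup.
    exists t => g [->|[k [_ kt ->]]].
      by apply: le_trans nt; rewrite mulr_ge0// ltW.
    by apply: le_trans kt; rewrite ler_pM2r// ler_nat.
  case: h3 => [an|[a0 Bl]]; [left|right].
    by rewrite /l an subnn mul0r.
  exists l; split => //; apply: le_trans nt.
  by rewrite ler_pM2r// ler_nat /l; lia.
Qed.

Notation mu := (@lebesgue_measure R).
Notation current_age := (fun t : R => t - last_generation t).

(** The slot is half-open because its own delivery already counts at (n + 1) T. With a the age at
    its start, the AoI rises linearly from a T to (a + 1) T, whence the 1/2. *)
Lemma slot_integral n :
  mu.-integrable `[n%:R * T, n.+1%:R * T[ (EFin \o current_age) /\
  \int[mu]_(t in `[n%:R * T, n.+1%:R * T[) current_age t =
    T ^+ 2 * ((age (history B n))%:R + 2^-1).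
Proof.
set c := (n - age (history B n))%:R * T.
have ab : n%:R * T < n.+1%:R * T by rewrite ltr_pM2r// ltr_nat.
have eqc t : t \in `[n%:R * T, n.+1%:R * T[%classic -> t - c = current_age t.
  by rewrite in_setE /= in_itv/= => /last_generationE ->.
have cfc : continuous (fun t : R => t - c).
  by move=> t; apply: cvgB; [exact: cvg_id|exact: cvg_cst].
have ifc : mu.-integrable `[n%:R * T, n.+1%:R * T] (EFin \o (fun t : R => t - c)).
  by apply: continuous_compact_integrable; [exact: segment_compact|exact/continuous_subspaceT].
have ifc' : mu.-integrable `[n%:R * T, n.+1%:R * T[ (EFin \o (fun t : R => t - c)).
  apply: integrableS ifc => //; apply: subset_itvl.
  by rewrite bnd_simp.
split.
  by apply: eq_integrable ifc' => // t /eqc /= ->.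
have <- : \int[mu]_(t in `[n%:R * T, n.+1%:R * T[) (t - c) =
    \int[mu]_(t in `[n%:R * T, n.+1%:R * T[) current_age t.
  by apply: eq_Rintegral => t /eqc.
rewrite Rintegral_itv_bndo_bndc//.
pose F (t : R) : R := 2^-1 * (t - c) ^+ 2.
have dF (t : R) : is_derive t 1 F (t - c).
  rewrite /F; apply: is_derive_eq.
  by rewrite /GRing.scale /= !subr0 !mulr1; field.
have cF : continuous F.
  by move=> t; apply: differentiable_continuous; apply/derivable1_diffP; case: (dF t).
rewrite /Rintegral (@continuous_FTC2 _ _ F)//=.
- have [h1 _ _] := age_history_last B n.
  by rewrite /F /c natrB// -natr1; field.
- exact: continuous_subspaceT.
- split.
  + by move=> x _; case: (dF x).
  + by apply: cvg_at_right_filter; exact: cF.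
  + by apply: cvg_at_left_filter; exact: cF.
- by move=> x _; rewrite derive1E; case: (dF x).
Qed.

Lemma frame_integral N :
  mu.-integrable `[0, N%:R * T[ (EFin \o current_age) /\
  \int[mu]_(t in `[0, N%:R * T[) current_age t =
    T ^+ 2 * ((age_sum (history B N))%:R + N%:R / 2).
Proof.
elim: N => [|N [IHi IH]].
  rewrite mul0r set_itvco0; split; first exact: integrable_set0.
  by rewrite Rintegral_set0 /= mul0r addr0 mulr0.
have [si s] := slot_integral N.
have Ncat : `[0, N.+1%:R * T[%classic = `[0, N%:R * T[ `|` `[N%:R * T, N.+1%:R * T[.
  by apply: itv_bndbnd_setU; rewrite bnd_simp ?ler_pM2r ?ler_nat// mulr_ge0// ltW.
have dj : [disjoint `[0, N%:R * T[%classic & `[N%:R * T, N.+1%:R * T[%classic].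
  apply/disj_setPS => t []/=; rewrite !in_itv/= => /andP[_ h] /andP[h' _].
  by move: (lt_le_trans h h'); rewrite ltxx.
have iN : mu.-integrable `[0, N.+1%:R * T[ (EFin \o current_age).
  by rewrite Ncat; exact: integrable_setU.
split => //; rewrite Ncat Rintegral_setU -?Ncat//.
by rewrite IH s /= natrD -natr1; field.
Qed.

Lemma current_age_ge0 t : 0 <= t -> 0 <= current_age t.
Proof.
move=> t0; rewrite subr_ge0; apply: ge_sup; first by exists 0; left.
move=> g [->//|[n [_ nt ->]]]; apply: le_trans nt.
by rewrite ler_pM2r// ler_nat.
Qed.

Lemma integrable_current_age t : mu.-integrable `[0, t] (EFin \o current_age).
Proof.
have [iN _] := frame_integral (Num.truncn (t / T)).+1.
apply: integrableS iN => //; apply: subset_itvl => /=.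
by rewrite bnd_simp -ltr_pdivrMr// truncnS_gt.
Qed.

Lemma average_age_cvg r :
  (age_sum (history B (k.+1 ^ 2)))%:R / k.+1%:R ^+ 2 @[k --> \oo] --> (r : R) ->
  tau^-1 * \int[mu]_(t in `[0, tau]) current_age t @[tau --> +oo] -->
    T * (r + 2^-1).
Proof.
move=> hr.
apply: (@square_interpolation _ T _
  (fun tau => \int[mu]_(t in `[0, tau]) current_age t)) => //.
- move=> x y; rewrite !nnegrE => x0 y0 xy.
  rewrite /Rintegral; apply: fine_le.
  + exact: integrable_fin_num (integrable_current_age _).
  + exact: integrable_fin_num (integrable_current_age _).
  + apply: ge0_subset_integral => //.
    * by case/integrableP: (integrable_current_age y).
    * by move=> z /=; rewrite in_itv/= => /andP[z0 _]; rewrite lee_fin current_age_ge0.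
    * by apply: subset_itvl; rewrite bnd_simp.
- apply: Rintegral_ge0 => x /=; rewrite in_itv/= => /andP[x0 _].
  exact: current_age_ge0.
- apply: (@cvg_trans _ (T * ((age_sum (history B (k.+1 ^ 2)))%:R / k.+1%:R ^+ 2
      + 2^-1) @[k --> \oo])).
    apply: near_eq_cvg; apply: nearW => k.
    have [iN IN] := frame_integral (k.+1 ^ 2).
    rewrite -natrX -Rintegral_itv_bndo_bndc// IN.
    have : (k.+1 ^ 2)%:R != 0 :> R by rewrite pnatr_eq0.
    by move: (_ ^ 2)%:R => x x0; field; rewrite x0 gt_eqF.
  by apply: cvgM; [exact: cvg_cst|apply: cvgD; [exact: hr|exact: cvg_cst]].
Qed.

(** This settles q = 0: the age is t itself, and its average tau / 2 diverges. *)
Lemma average_age_cvgy : (forall n, ~~ B n) ->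
  (tau^-1 * \int[mu]_(t in `[0, tau]) current_age t)%:E @[tau --> +oo%R] --> +oo%E.
Proof.
move=> B0.
have ageE t : current_age t = t.
  rewrite /last_generation (_ : [set g | _] = [set 0]) ?sup1 ?subr0//.
  by apply/seteqP; split => [g [//|[n [Bn]]]|g ->]; [move: Bn; rewrite (negbTE (B0 n))|left].
have intE tau : 0 < tau ->
    \int[mu]_(t in `[0, tau]) current_age t = 2^-1 * tau ^+ 2.
  move=> tau0; under eq_Rintegral do rewrite ageE.
  have dF (t : R) : is_derive t 1 (fun t : R => 2^-1 * t ^+ 2) t.
    apply: is_derive_eq.
    by rewrite /GRing.scale /= !mulr1; field.
  have cF : continuous (fun t : R => 2^-1 * t ^+ 2).
    by move=> t; apply: differentiable_continuous; apply/derivable1_diffP; case: (dF t).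
  rewrite /Rintegral (@continuous_FTC2 _ _ (fun t : R => 2^-1 * t ^+ 2))//=.
  - by rewrite expr0n mulr0 subr0.
  - by apply: continuous_subspaceT => x; exact: cvg_id.
  - split.
    + by move=> x _; case: (dF x).
    + by apply: cvg_at_right_filter; exact: cF.
    + by apply: cvg_at_left_filter; exact: cF.
  - by move=> x _; rewrite derive1E; case: (dF x).
apply/cvgeryP; apply: (@cvg_trans _ (2^-1 * tau @[tau --> +oo])).
  apply: near_eq_cvg; near=> tau.
  have tau0 : 0 < tau by near: tau; apply: nbhs_pinfty_gt; exact: num_real.
  by rewrite intE//; field; rewrite gt_eqF.
apply: gt0_cvgMry => //; exact: cvg_id.
Unshelve. all: by end_near. Qed.

End deterministic_age.

(** * Almost sure convergence *)

Lemma sum_inv_square_lty (R : realType) (c : R) : 0 <= c ->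
  (\sum_(0 <= k <oo) (c / k.+1%:R ^+ 2)%:E < +oo)%E.
Proof.
move=> c0.
(* Telescoping majorant: 1 / (n + 1)^2 <= 2 / (n + 1) - 2 / (n + 2), with difference n / ((n + 1)^2
   (n + 2)). *)
have partial n : \sum_(0 <= k < n) (c / k.+1%:R ^+ 2) <= c * (2 - 2 / n.+1%:R).
  elim: n => [|n IH]; first by rewrite big_geq// divr1 subrr mulr0.
  rewrite big_nat_recr//=; apply: le_trans (lerD IH (lexx _)) _.
  rewrite -mulrDr ler_wpM2l// -(natr1 n.+1) -(natr1 n).
  have n0 : (0 : R) <= n%:R by [].
  move: n%:R n0 => x x0.
  rewrite -subr_ge0.
  have -> : 2 - 2 / (x + 1 + 1) - (2 - 2 / (x + 1) + ((x + 1) ^+ 2)^-1) =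
    x / ((x + 1) ^+ 2 * (x + 2)) by field; rewrite !gt_eqF//; lra.
  by rewrite divr_ge0// mulr_ge0// ?sqr_ge0//; lra.
apply: (@le_lt_trans _ _ (2 * c)%:E); last exact: ltry.
apply: lime_le.
  by apply: is_cvg_nneseries => n _ _; rewrite lee_fin divr_ge0// sqr_ge0.
apply: nearW => n; rewrite sumEFin lee_fin; apply: le_trans (partial n) _.
by rewrite mulrC ler_wpM2r// lerBlDr lerDl divr_ge0.
Qed.

Section bernoulli_process.
Context d (Omega : measurableType d) (R : realType) (Pr : probability Omega R).
Variables (B : nat -> Omega -> bool) (q : R).
Hypothesis mB : forall n, measurable [set w | B n w].
Hypothesis q01 : 0 <= q <= 1.

Let weight (x : bool) : R := if x then q else 1 - q.

Hypothesis B_law : forall N (c : nat -> bool),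
  Pr [set w | forall n, (n < N)%N -> B n w = c n] = (\prod_(n < N) weight (c n))%:E.

Notation hist := (fun N w => history (fun n => B n w) N).

Lemma measurable_bit n x : measurable [set w | B n w = x].
Proof.
case: x; first exact: mB.
rewrite (_ : [set w | _] = ~` [set w | B n w]); first exact: measurableC.
by apply/seteqP; split => w /=; case: (B n w).
Qed.

Lemma measurable_history (f : pred (seq bool)) N :
  measurable [set w | f (hist N w)].
Proof.
elim: N f => [|N IH] f /=.
  by case: (f [::]); rewrite ?set_true ?set_false.
rewrite (_ : [set w | _] =
    ([set w | B N w = true] `&` [set w | f (true :: hist N w)]) `|`
    ([set w | B N w = false] `&` [set w | f (false :: hist N w)])).
  apply: measurableU; apply: measurableI; try exact: measurable_bit.
    exact: (IH (fun b => f (true :: b))).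
  exact: (IH (fun b => f (false :: b))).
apply/seteqP; split => w /=; first by case: (B N w) => ?; [left|right].
by move=> [] [->].
Qed.

(** [B_law] only gives the probability of a fully prescribed pattern. The prescribed block from N to
    L makes the induction work: the newest bit of the history is split by value and moved into the
    block, until no history is left. *)
Lemma history_joint_law N L (c : nat -> bool) (f : pred (seq bool)) : (N <= L)%N ->
  Pr [set w | f (hist N w) /\ forall n, (N <= n < L)%N -> B n w = c n] =
  (bit_expect q N (fun b => (f b)%:R) * \prod_(N <= n < L) weight (c n))%:E.
Proof.
elim: N c f => [|N IH] c f NL /=.
  case: (f [::]).
    rewrite mul1r big_mkord -B_law; congr (Pr _).
    by apply/seteqP; split => w /=; [case|].
  by rewrite mul0r (_ : [set w | _] = set0) ?measure0//; apply/seteqP; split => w [].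
pose cx (x : bool) n := if n == N then x else c n.
pose E x := [set w | f (x :: hist N w) /\ forall n, (N <= n < L)%N -> B n w = cx x n].
have mE x : measurable (E x).
  rewrite /E (_ : [set w | _] = [set w | f (x :: hist N w)] `&`
      \bigcap_(n in [set n | (N <= n < L)%N]) [set w | B n w = cx x n])//.
  apply: measurableI; first exact: (measurable_history (fun b => f (x :: b))).
  by apply: bigcap_measurableType => n _; exact: measurable_bit.
have PE x : Pr (E x) = (bit_expect q N (fun b => (f (x :: b))%:R) *
    (weight x * \prod_(N.+1 <= n < L) weight (c n)))%:E.
  rewrite (IH (cx x) (fun b => f (x :: b))) ?(ltnW NL)//.
  rewrite big_ltn// /cx eqxx; congr (_ * (_ * _))%:E.
  by apply: eq_big_nat => n /andP[Nn _]; rewrite gtn_eqF.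
rewrite (_ : [set w | _] = E true `|` E false); last first.
  apply/seteqP; split => w /=.
    case=> fw h; case BN : (B N w) fw => fw; [left|right]; split => // n /andP[];
      rewrite leq_eqVlt => /predU1P[<-|Nn] nL; rewrite /cx ?eqxx// ?gtn_eqF//;
      by apply: h; rewrite Nn.
  have hN : (N <= N < L)%N by rewrite leqnn.
  case=> -[fw h]; (split; first by rewrite (h _ hN) /cx eqxx);
    by move=> n /andP[Nn nL]; rewrite h ?(ltnW Nn)// /cx gtn_eqF.
rewrite measureU//; last first.
  apply/seteqP; split => // w [[_ /(_ N)] + [_ /(_ N)]].
  by rewrite /cx eqxx leqnn NL => -> // /(_ isT).
rewrite [RHS]EFinM.
transitivity ((Pr (E true) + Pr (E false))%E) => //; rewrite !PE -EFinD -EFinM.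
rewrite bit_expectD !bit_expectZ; congr EFin; rewrite /weight; ring.
Qed.

Lemma history_law N (f : pred (seq bool)) :
  Pr [set w | f (hist N w)] = (bit_expect q N (fun b => (f b)%:R))%:E.
Proof.
have := history_joint_law (fun=> true) f (leqnn N); rewrite big_geq// mulr1 => <-.
by congr (Pr _); apply/seteqP; split => w /= => [fw|[]//]; split => // n; case: ltngtP.
Qed.

(** The indicator is dominated by the normalized square under [bit_expect], so no integral over the
    outcome space is needed. The bound is of order 1 / N: not summable over N, but summable along N
    = (k + 1)^2. *)
Lemma age_sum_chebyshev N (e : R) : 0 < q -> 0 < e -> (0 < N)%N ->
  (Pr [set w | (e * N%:R <= `|(age_sum (hist N w))%:R - N%:R / q|)%R] <=
   (2 * (q ^- 2 + 2 * q ^- 3) / e ^+ 2 / N%:R)%:E)%E.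
Proof.
move=> q0 e0 N0.
rewrite (history_law N (fun b => e * N%:R <= `|(age_sum b)%:R - N%:R / q|)) lee_fin.
have N0' : (0 : R) < N%:R by rewrite ltr0n.
apply: (@le_trans _ _ ((e * N%:R) ^- 2 *
    bit_expect q N (fun b => ((age_sum b)%:R - N%:R / q) ^+ 2))).
  rewrite -bit_expectZ; apply: le_bit_expect => // b _.
  have eN : 0 < e * N%:R by rewrite mulr_gt0.
  have [h|h] /= := boolP (e * N%:R <= `|(age_sum b)%:R - N%:R / q|); last first.
    by rewrite mulr_ge0 ?invr_ge0// sqr_ge0.
  rewrite mulrC ler_pdivlMr ?exprn_gt0// mul1r -[leRHS]real_normK ?num_real//.
  by rewrite ler_sqr ?nnegrE// ltW.
apply: le_trans (ler_wpM2l _ (age_sum_second_moment _ N)) _.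
- by rewrite invr_ge0 exprn_ge0// mulr_ge0// ltW.
- by rewrite q0; case/andP: q01.
- rewrite le_eqVlt; apply/orP; left; apply/eqP; field.
  by rewrite !gt_eqF.
Qed.

Lemma age_sum_square_cvg : 0 < q -> \forall w \ae Pr,
  (age_sum (hist (k.+1 ^ 2)%N w))%:R / k.+1%:R ^+ 2 @[k --> \oo] --> q^-1.
Proof.
move=> q0.
(* Tolerances are restricted to 1 / (j + 1), so that the null sets given by Borel-Cantelli are
   countably many. *)
pose F (j k : nat) : set Omega := [set w | j.+1%:R^-1 * (k.+1 ^ 2)%:R <=
  `|(age_sum (hist (k.+1 ^ 2)%N w))%:R - (k.+1 ^ 2)%:R / q|].
have mF j k : measurable (F j k).
  exact: (measurable_history (fun b => j.+1%:R^-1 * (k.+1 ^ 2)%:R <=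
    `|(age_sum b)%:R - (k.+1 ^ 2)%:R / q|)).
have F0 j : Pr (lim_sup_set (F j)) = 0%E.
  apply: lim_sup_set_cvg0 => //.
  pose C := 2 * (q ^- 2 + 2 * q ^- 3) / j.+1%:R^-1 ^+ 2.
  apply: le_lt_trans (@sum_inv_square_lty R C _).
    apply: lee_nneseries => // k _.
    rewrite -natrX; apply: age_sum_chebyshev => //.
  rewrite /C divr_ge0 ?mulr_ge0 ?addr_ge0 ?mulr_ge0 ?invr_ge0 ?exprn_ge0//; exact: ltW.
have : \forall w \ae Pr, forall j, ~ lim_sup_set (F j) w.
  apply: ae_foralln => j; exists (lim_sup_set (F j)); split => //.
    by apply: bigcap_measurable => // n _; apply: bigcup_measurable.
    exact: F0.
  by move=> w /= /contrapT.
apply: filterS => w hw; apply/cvgrPdist_lt => e e0.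
have [j je] : exists j : nat, j.+1%:R^-1 < e.
  exists (Num.truncn e^-1); rewrite invf_plt ?posrE ?ltr0n//; exact: truncnS_gt.
have [n hn] : exists n, forall k, (n <= k)%N -> ~ F j k w.
  apply: contrapT => h; apply: (hw j) => n _.
  apply: contrapT => h'; apply: h; exists n => k nk Fk; apply: h'.
  by exists k.
exists n => // k nk; have /negP := hn k nk; rewrite -ltNge -natrX.
have k0 : (0 : R) < (k.+1 ^ 2)%:R by rewrite ltr0n expn_gt0.
move: (age_sum _)%:R (_ ^ 2)%:R k0 => S K K0 h.
rewrite (_ : q^-1 - S / K = - ((S - K / q) / K)); last by field; rewrite !gt_eqF.
rewrite normrN normrM normfV (gtr0_norm K0) ltr_pdivrMr//.
by apply: lt_trans h _; rewrite ltr_pM2r.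
Qed.

Lemma no_success_ae : q = 0 -> \forall w \ae Pr, forall n, ~~ B n w.
Proof.
move=> q0; apply: ae_foralln => n; exists [set w | B n w]; split => //; last first.
  by move=> w /= /negP; rewrite negbK.
pose f (b : seq bool) := head false b.
have := history_law n.+1 f; rewrite /= q0.
by rewrite bit_expect_cst mul0r mulr0 addr0.
Qed.

End bernoulli_process.

(** * Independence across users and slots *)

Lemma measure_finite_valued d (Omega : measurableType d) (R : realType)
    (mu : {measure set Omega -> \bar R}) (S : finType) (Y : Omega -> S) (D : pred S) :
  (forall s, measurable [set w | Y w = s]) ->
  mu [set w | D (Y w)] = (\sum_(s | D s) mu [set w | Y w = s])%E.
Proof.
move=> mY; rewrite (_ : [set w | D (Y w)] = \bigcup_(s in [set s | D s]) [set w | Y w = s]).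
  rewrite measure_fin_bigcup//.
  - rewrite (fsbigE [seq s <- enum S | D s])//=.
    + rewrite big_filter_cond big_enum_cond/=; apply: eq_bigl => s.
      by rewrite mem_setE/= andbb.
    + by rewrite filter_uniq// enum_uniq.
    + by move=> s /=; rewrite mem_filter => /andP[].
    + by move=> s /= Ds; rewrite mem_filter mem_enum Ds.
  - exact: finite_finset.
  - by move=> s t _ _ [w [/= <- <-]].
by apply/seteqP; split => [w Dw|w [s Ds /= ->]//]; exists (Y w).
Qed.

Section slot_law.
Variables (R : realType) (M : nat) (p : R) (X : access_model M p).
Variables (S : finType) (symbol : draw R -> S).
Hypothesis measurable_symbol : forall s, measurable [set x | symbol x = s].
Variable success : {ffun 'I_M -> S} -> bool.

Notation weight := (fun s => fine (draw_law p [set x | symbol x = s])).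

Let slot (n : nat) (w : outcome X) : {ffun 'I_M -> S} :=
  [ffun v => symbol (draws X (v, n) w)].

Let frame N (w : outcome X) : {ffun 'I_N -> {ffun 'I_M -> S}} :=
  [ffun n => slot (val n) w].

Let weightE s : draw_law p [set x | symbol x = s] = (weight s)%:E.
Proof. by rewrite fineK// fin_num_measure. Qed.

Let measurable_draw i s : measurable [set w | symbol (draws X i w) = s].
Proof.
have := measurable_funPT (draws X i) measurableT _ (measurable_symbol s).
by rewrite setTI.
Qed.

Let measurable_frame N sigma : measurable [set w | @frame N w = sigma].
Proof.
rewrite (_ : [set w | _] = \bigcap_(x in [set: 'I_M * 'I_N])
    [set w | symbol (draws X (x.1, val x.2) w) = sigma x.2 x.1]).
  by apply: fin_bigcap_measurable => [|x _]; [exact: finite_finset|exact: measurable_draw].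
apply/seteqP; split => w /= h.
  by move=> [v n] _ /=; rewrite -h !ffunE.
by apply/ffunP => n; apply/ffunP => v; rewrite !ffunE; exact: (h (v, n)).
Qed.

Lemma frame_law N sigma :
  Pr X [set w | @frame N w = sigma] = (\prod_n \prod_v weight (sigma n v))%:E.
Proof.
pose h (x : 'I_M * 'I_N) : 'I_M * nat := (x.1, val x.2).
pose J := [fset h x | x in [set: 'I_M * 'I_N]%SET]%fset.
(* Only slots below N occur in [J]; beyond them [insub] fails and [setT] merely makes the family
   total. *)
pose A (i : 'I_M * nat) : set (draw R) :=
  if insub i.2 is Some n then [set x | symbol x = sigma n i.1] else setT.
have mA i : measurable (A i) by rewrite /A; case: insubP.
have Ah x : A (h x) = [set y | symbol y = sigma x.2 x.1].
  by rewrite /A /h /= valK.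
rewrite (_ : [set w | _] = \bigcap_(i in [set` J]) (draws X i @^-1` A i)); last first.
  apply/seteqP; split => w /= hw.
    move=> i /= /imfsetP[x _ ->]; rewrite /preimage Ah /= -hw !ffunE.
    by [].
  apply/ffunP => n; apply/ffunP => v; rewrite !ffunE.
  have hJ : h (v, n) \in J by apply: in_imfset; rewrite inE.
  by have : A (h (v, n)) (draws X (h (v, n)) w) := hw _ hJ; rewrite Ah.
rewrite draws_indep// big_imfset; last first.
  by move=> [v n] [v' n'] _ _ [-> /val_inj ->].
rewrite (perm_big (enum (fintype.Finite.clone _ ('I_M * 'I_N)%type)))/=; last first.
  apply: uniq_perm; rewrite ?enum_uniq ?enum_finmem_uniq// => x.
  by rewrite !mem_enum !inE.
rewrite big_enum/= exchange_big pair_big -prodEFin; apply: eq_bigr => x _.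
rewrite -weightE -(Ah x).
exact: (draws_law X (h x) (mA (h x))).
Qed.

Definition success_prob : R :=
  \sum_(sigma | success sigma) \prod_v weight (sigma v).

Lemma sum_weight : \sum_s weight s = 1.
Proof.
apply: EFin_inj; rewrite -sumEFin; under eq_bigr do rewrite -weightE.
rewrite -(measure_finite_valued (draw_law p) predT)//.
by rewrite -(@probability_setT _ _ _ (draw_law p)); congr (_ _); apply/seteqP.
Qed.

Lemma success_probC :
  \sum_(sigma | ~~ success sigma) \prod_v weight (sigma v) = 1 - success_prob.
Proof.
apply/eqP; rewrite eq_sym subr_eq addrC; apply/eqP.
transitivity (\sum_(sigma : {ffun 'I_M -> S}) \prod_v weight (sigma v)).
  by rewrite -(bigA_distr_bigA (fun _ s => weight s)) big1// => v _; exact: sum_weight.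
by rewrite (bigID success).
Qed.

Lemma success_prob01 : 0 <= success_prob <= 1.
Proof.
have h (P : pred {ffun 'I_M -> S}) :
    0 <= \sum_(sigma | P sigma) \prod_v weight (sigma v).
  by apply: sumr_ge0 => sigma _; apply: prodr_ge0 => v _; rewrite fine_ge0.
by rewrite {1}/success_prob h /= -subr_ge0 -success_probC h.
Qed.

Lemma measurable_success n : measurable [set w | success (slot n w)].
Proof.
rewrite (_ : [set w | _] =
    \bigcup_(s in [set s | success s]) [set w | slot n w = s]); last first.
  by apply/seteqP; split => [w sw|w [s ss /= ->]//]; exists (slot n w).
apply: fin_bigcup_measurable => [|s _]; first exact: finite_finset.
rewrite (_ : [set w | _] = \bigcap_(v in [set: 'I_M])
    [set w | symbol (draws X (v, n) w) = s v]).
  by apply: fin_bigcap_measurable => [|v _]; [exact: finite_finset|exact: measurable_draw].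
apply/seteqP; split => w /= h; first by move=> v _ /=; rewrite -h ffunE.
by apply/ffunP => v; rewrite ffunE; exact: h.
Qed.

(** Expanding the product over slots of sums over configurations gives the sum over whole frames.
    The result is the factorization required of the bits as [B_law]. *)
Lemma success_law N (c : nat -> bool) :
  Pr X [set w | forall n, (n < N)%N -> success (slot n w) = c n] =
  (\prod_(n < N) (if c n then success_prob else 1 - success_prob))%:E.
Proof.
pose D (sigma : {ffun 'I_N -> {ffun 'I_M -> S}}) :=
  [forall n, success (sigma n) == c n].
rewrite (_ : [set w | _] = [set w | D (@frame N w)]); last first.
  apply/seteqP; split => w /=.
    move=> h; rewrite /D; apply/forallP => n; rewrite ffunE.
    by apply/eqP; exact: (h _ (ltn_ord n)).
  by move=> /forallP h n nN; have := h (Ordinal nN); rewrite ffunE => /eqP.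
rewrite measure_finite_valued; last exact: measurable_frame.
rewrite (eq_bigr _ (fun sigma _ => frame_law sigma)).
rewrite sumEFin; congr EFin.
transitivity (\prod_(n < N) \sum_(tau | success tau == c n) \prod_v weight (tau v)).
  rewrite (bigA_distr_big_dep _ (fun n (tau : {ffun 'I_M -> S}) => \prod_v weight (tau v))).
  by apply: eq_bigl => sigma; apply/forallP/familyP => h n; exact: h.
apply: eq_bigr => n _; case: (c n).
  by apply: eq_bigl => tau; rewrite eqb_id.
by rewrite -success_probC; apply: eq_bigl => tau; rewrite eqbF_neg.
Qed.

Lemma success_prob_rectangle (A : 'I_M -> pred S) :
  \sum_(sigma : {ffun 'I_M -> S} | [forall v, A v (sigma v)]) \prod_v weight (sigma v) =
  \prod_v fine (draw_law p [set x | A v (symbol x)]).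
Proof.
transitivity (\prod_v \sum_(s | A v s) weight s).
  rewrite (bigA_distr_big_dep _ (fun v s => weight s)).
  by apply: eq_bigl => sigma; apply/forallP/familyP => h n; exact: h.
apply: eq_bigr => v _; apply: EFin_inj; rewrite -sumEFin.
have mA : measurable [set x | A v (symbol x)].
  rewrite (_ : [set x | _] =
      \bigcup_(s in [set s | A v s]) [set x | symbol x = s]).
    by apply: fin_bigcup_measurable => [|s _]; [exact: finite_finset|exact: measurable_symbol].
  by apply/seteqP; split => [x Ax|x [s As /= ->]//]; exists (symbol x).
rewrite [RHS]fineK; last exact: fin_num_measure.
rewrite (measure_finite_valued (draw_law p) (A v) measurable_symbol).
by apply: eq_bigr => s _; rewrite -weightE.
Qed.

End slot_law.

(** * Success probabilities of the two schemes *)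

Definition fading_law (R : realType) :
    probability (measurableTypeR R * measurableTypeR R)%type R :=
  (normal_prob 0 (Num.sqrt 2^-1) \x normal_prob 0 (Num.sqrt 2^-1))%E.

Definition gain (R : realType) (z : measurableTypeR R * measurableTypeR R) : R :=
  (z.1 : R) ^+ 2 + (z.2 : R) ^+ 2.

Lemma measurable_gain (R : realType) : measurable_fun setT (@gain R).
Proof.
by apply: measurable_funD; apply: measurable_funX;
  [exact: measurable_fst|exact: measurable_snd].
Qed.

Lemma measurable_gain_ge (R : realType) (P theta : R) :
  measurable [set z | theta <= P * @gain R z].
Proof.
have mf : measurable_fun setT (fun z => P * @gain R z).
  by apply: measurable_funM => //; exact: measurable_gain.
have := mf measurableT _ (measurable_itv `[theta, +oo[); rewrite setTI.
by congr measurable; apply/seteqP; split => z /=; rewrite in_itv/= andbT.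
Qed.

Lemma measurable_rate_gt (R : realType) (P rate : R) :
  measurable [set z | rate < ln (1 + P * @gain R z) / ln 2].
Proof.
have mf : measurable_fun setT (fun z => ln (1 + P * @gain R z) / ln 2).
  apply: measurable_funM => //; apply: measurableT_comp => //.
  apply: measurable_funD => //.
  by apply: measurable_funM => //; exact: measurable_gain.
have := mf measurableT _ (measurable_itv `]rate, +oo[); rewrite setTI.
by congr measurable; apply/seteqP; split => z /=; rewrite in_itv/= andbT.
Qed.

Lemma bernoulli_prob_set1 (R : realType) (p : R) b : 0 <= p <= 1 ->
  bernoulli_prob p [set b] = (if b then p else 1 - p)%:E.
Proof.
have inb x : (x \in [set b]) = (x == b) by apply/idP/eqP; rewrite inE.
move=> p01; rewrite bernoulli_probE// !diracE !inb; case: b {inb} => /=.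
  by rewrite mule1 mule0 adde0.
by rewrite mule0 mule1 add0e.
Qed.

Lemma draw_law_rectangle (R : realType) (p : R) (A L : set bool)
    (G : set (measurableTypeR R * measurableTypeR R)) : measurable G ->
  draw_law p [set x | [/\ A x.1.1, L x.1.2 & G x.2]] =
  (bernoulli_prob p A * bernoulli_prob (2^-1 : R) L * fading_law R G)%E.
Proof.
move=> mG; rewrite (_ : [set x | _] = (A `*` L) `*` G); last first.
  by apply/seteqP; split => [x []//|x [[]]].
transitivity ((bernoulli_prob p \x bernoulli_prob (2^-1 : R)) (A `*` L) *
    fading_law R G)%E.
  by apply: product_measure1E => //; exact: measurableX.
by congr (_ * _)%E; exact: product_measure1E.
Qed.

Definition oma_symbol (R : realType) (P rate : R) (x : draw R) : bool * bool :=
  (attempts x, rate < ln (1 + P * gain2 x) / ln 2).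

Definition oma_event M (u : 'I_M) (sigma : {ffun 'I_M -> bool * bool}) : bool :=
  [&& (sigma u).1, [forall v, (v != u) ==> ~~ (sigma v).1] & (sigma u).2].

(** An infeasible choice is recorded as (false, false), like silence. The symbol (true, true) never
    occurs, since a draw has one level. *)
Definition noma_symbol (R : realType) M (P rate : R) (x : draw R) : bool * bool :=
  (transmits_at M P rate true x, transmits_at M P rate false x).

Definition noma_event M (u : 'I_M) (sigma : {ffun 'I_M -> bool * bool}) : bool :=
  ((sigma u).1 && (#|[pred v | (sigma v).1]| == 1)%N) ||
  [&& (sigma u).2, (#|[pred v | (sigma v).2]| == 1)%N
    & (#|[pred v | (sigma v).1]| <= 1)%N].

Lemma measurable_draw_set (R : realType) (A L : set bool)
    (G : set (measurableTypeR R * measurableTypeR R)) : measurable G ->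
  measurable [set x : draw R | [/\ A x.1.1, L x.1.2 & G x.2]].
Proof.
move=> mG; rewrite (_ : [set x | _] = (A `*` L) `*` G); last first.
  by apply/seteqP; split => [x []//|x [[]]].
by apply: measurableX => //; exact: measurableX.
Qed.

Lemma measurable_pair_symbol d (S : measurableType d) (f g : S -> bool) s :
  measurable [set x | f x] -> measurable [set x | g x] ->
  measurable [set x | (f x, g x) = s].
Proof.
have key (h : S -> bool) b : measurable [set x | h x] -> measurable [set x | h x = b].
  case: b => // mh; rewrite (_ : [set x | _] = ~` [set x | h x]).
    exact: measurableC.
  by apply/seteqP; split => x /=; case: (h x).
case: s => a b mf mg.
rewrite (_ : [set x | _] = [set x | f x = a] `&` [set x | g x = b]).
  by apply: measurableI; exact: key.
by apply/seteqP; split => x /= [-> ->].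
Qed.

Section oma.
Variables (R : realType) (P rate : R).

Lemma measurable_oma_symbol s : measurable [set x | oma_symbol P rate x = s].
Proof.
apply: measurable_pair_symbol.
  have := @measurable_draw_set R [set true] setT setT measurableT.
  by congr measurable; apply/seteqP; split => [x []//|x /= xt]; split.
have := @measurable_draw_set R setT setT _ (measurable_rate_gt P rate).
by congr measurable; apply/seteqP; split => [x []//|x /= xt]; split.
Qed.

Definition oma_availability : R :=
  fine (fading_law R [set z | rate < ln (1 + P * gain z) / ln 2]).

Lemma oma_success_prob p m (u : 'I_m.+1) : 0 <= p <= 1 ->
  success_prob p (oma_symbol P rate) (oma_event u) =
  p * oma_availability * (1 - p) ^+ m.
Proof.
move=> p01.
pose A (v : 'I_m.+1) : pred (bool * bool) :=
  fun s => if v == u then s.1 && s.2 else ~~ s.1.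
transitivity (\prod_v fine (draw_law p [set x | A v (oma_symbol P rate x)])).
  rewrite -success_prob_rectangle; last exact: measurable_oma_symbol.
  apply: eq_bigl => sigma; apply/and3P/forallP.
    move=> [su1 /forallP su su2] v; rewrite /A; case: eqP => [->|/eqP vu].
      by rewrite su1.
    by have := su v; rewrite vu.
  move=> h; have := h u; rewrite /A eqxx => /andP[-> ->]; split => //.
  by apply/forallP => v; apply/implyP => vu; have := h v; rewrite /A (negbTE vu).
rewrite (bigD1 u)//= (eq_bigr (fun=> 1 - p)); last first.
  move=> v vu; rewrite /A (negbTE vu) (_ : [set x | _] =
    [set x | [/\ [set false] x.1.1, setT x.1.2 & setT x.2]]).
    rewrite draw_law_rectangle// bernoulli_prob_set1//.
    by rewrite !probability_setT !mule1.
  apply/seteqP; split => x /=; rewrite /attempts.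
    by case: x.1.1.
  by case=> ->.
rewrite prodr_const; congr (_ * _ ^+ _); last first.
  by rewrite cardC1 card_ord.
rewrite /A eqxx (_ : [set x | _] = [set x | [/\ [set true] x.1.1, setT x.1.2 &
    [set z | rate < ln (1 + P * gain z) / ln 2] x.2]]).
  rewrite draw_law_rectangle ?bernoulli_prob_set1//; last exact: measurable_rate_gt.
  rewrite probability_setT mule1 fineM// ?fin_num_measure//.
  exact: measurable_rate_gt.
apply/seteqP; split => -[[a l] z]; rewrite /oma_symbol /attempts /=.
  by case/andP.
by case=> -> _.
Qed.

Lemma delivered_oma M p (X : access_model M p) u n w :
  delivered OMA rate P u n w =
  oma_event u [ffun v => oma_symbol P rate (draws X (v, n) w)].
Proof.
rewrite /delivered /= /oma_success /oma_event !ffunE; congr [&& _, _ & _].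
by apply: eq_forallb => v; rewrite ffunE.
Qed.

End oma.

Section noma.
Variables (R : realType) (M : nat) (P rate : R).

Lemma measurable_transmits_at b : measurable [set x | transmits_at M P rate b x].
Proof.
have := @measurable_draw_set R [set true] [set b] _
  (measurable_gain_ge P (snr_level M rate b)).
congr measurable; apply/seteqP; split => -[[a l] z]; rewrite /transmits_at /=.
  by case=> -> -> h; rewrite eqxx.
by case/and3P => ? /eqP.
Qed.

Lemma measurable_noma_symbol s : measurable [set x | noma_symbol M P rate x = s].
Proof. by apply: measurable_pair_symbol; exact: measurable_transmits_at. Qed.

Definition noma_availability b : R :=
  fine (fading_law R [set z | snr_level M rate b <= P * gain z]).

Lemma draw_law_transmits_at p b : 0 <= p <= 1 ->
  fine (draw_law p [set x | transmits_at M P rate b x]) =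
  p * (noma_availability b / 2).
Proof.
move=> p01; have half : 0 <= (2^-1 : R) <= 1 by lra.
rewrite (_ : [set x | _] = [set x | [/\ [set true] x.1.1, [set b] x.1.2 &
    [set z | snr_level M rate b <= P * gain z] x.2]]).
  rewrite draw_law_rectangle ?bernoulli_prob_set1//; last exact: measurable_gain_ge.
  rewrite !fineM// ?fin_num_measure//; last exact: measurable_gain_ge.
  by rewrite /noma_availability; case: b => /=; field.
apply/seteqP; split => -[[a l] z]; rewrite /transmits_at /=.
  by case/and3P => ? /eqP.
by case=> -> -> h; rewrite eqxx.
Qed.

Lemma delivered_noma p (X : access_model M p) u n w :
  delivered NOMA rate P u n w =
  noma_event u [ffun v => noma_symbol M P rate (draws X (v, n) w)].
Proof.
rewrite /delivered /= /noma_success /noma_event !ffunE /= /load.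
have e1 : #|[pred v | ([ffun v => noma_symbol M P rate (draws X (v, n) w)] v).1]| =
    #|[pred v | transmits_at M P rate true (draws X (v, n) w)]|.
  by apply: eq_card => v; rewrite !inE ffunE.
have e2 : #|[pred v | ([ffun v => noma_symbol M P rate (draws X (v, n) w)] v).2]| =
    #|[pred v | transmits_at M P rate false (draws X (v, n) w)]|.
  by apply: eq_card => v; rewrite !inE ffunE.
by rewrite e1 e2.
Qed.

End noma.

(** * Combinatorics of a NOMA slot *)

Lemma card_eq1_self M (u : 'I_M) (f : pred 'I_M) : f u ->
  (#|[pred v | f v]| == 1)%N = [forall v, (v != u) ==> ~~ f v].
Proof.
move=> fu; apply/eqP/forallP => [/mem_card1[z hz] v|h].
  have /eqP uz : u == z by have := hz u; rewrite !inE fu.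
  by apply/implyP => vu; have := hz v; rewrite !inE -uz (negbTE vu) => ->.
apply: (@fintype.eq_card1 _ u) => v; rewrite !inE.
by have [->//|vu] := eqVneq v u; have := h v; rewrite vu => /negbTE.
Qed.

(** At most one z can satisfy the condition, so the indicator of a single transmitter splits into a
    sum over candidates. Unlike the cardinality, each summand prescribes every user separately,
    which is what independence can use. *)
Lemma card_eq1_others M (u : 'I_M) (f : pred 'I_M) : ~~ f u ->
  (#|[pred v | f v]| == 1)%N = (\sum_(z | z != u)
    [forall v, (v != u) ==> (f v == (v == z))])%N :> nat.
Proof.
move=> fu; have fneq z : f z -> z != u by apply: contraTneq => ->.
have [/eqP /mem_card1[z fz]|f1] := boolP (_ == _).
  have fzz : f z by have := fz z; rewrite !inE eqxx.
  rewrite (bigD1 z) ?fneq//= big1 ?addn0.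
    by apply/esym/eqP; rewrite eqb1; apply/forallP => v; apply/implyP => _;
      apply/eqP; have := fz v; rewrite !inE.
  move=> t /andP[tu tz]; apply/eqP; rewrite eqb0; apply/forallPn; exists z.
  by rewrite negb_imply fneq// fzz [z == t]eq_sym (negbTE tz).
rewrite big1// => z zu; apply/eqP; rewrite eqb0; apply: contra f1 => /forallP h.
apply/eqP/(@fintype.eq_card1 _ z) => v; rewrite !inE.
have [->|vu] := eqVneq v u; first by rewrite (negbTE fu) eq_sym (negbTE zu).
by have := h v; rewrite vu => /eqP.
Qed.

Lemma card_eq0_others M (u : 'I_M) (f : pred 'I_M) : ~~ f u ->
  (#|[pred v | f v]| == 0)%N = [forall v, (v != u) ==> ~~ f v].
Proof.
move=> fu; apply/eqP/forallP => [/card0_eq h v|h].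
  by apply/implyP => _; have := h v; rewrite !inE => ->.
apply: eq_card0 => v; rewrite !inE; have [->|vu] := eqVneq v u; first exact/negbTE.
by have := h v; rewrite vu => /negbTE.
Qed.

(* The tagged user succeeds in exactly one of three ways: alone at the first
   level, alone at the second level with nobody else transmitting, or alone at
   the second level with a single user z at the first level. *)
Lemma noma_event_decomposition M (u : 'I_M) sigma : (noma_event u sigma : nat) =
  ([&& (sigma u).1 & [forall v, (v != u) ==> ~~ (sigma v).1]] +
   [&& ~~ (sigma u).1, (sigma u).2 &
     [forall v, (v != u) ==> (~~ (sigma v).1 && ~~ (sigma v).2)]] +
   \sum_(z | z != u) [&& ~~ (sigma u).1, (sigma u).2 &
     [forall v, (v != u) ==> (((sigma v).1 == (v == z)) && ~~ (sigma v).2)]])%N.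
Proof.
rewrite /noma_event; have [su1|su1] /= := boolP (sigma u).1.
  rewrite big1// !addn0; congr nat_of_bool.
  have e := card_eq1_self (f := fun v => (sigma v).1) su1.
  rewrite e; case: [forall _, _] e => //= e; apply/negP => /and3P[_ _].
  rewrite leq_eqVlt e ltnS leqn0 => /eqP/card0_eq/(_ u).
  by rewrite !inE su1.
rewrite add0n; have [su2|su2] /= := boolP (sigma u).2; last by rewrite big1.
rewrite (card_eq1_self (f := fun v => (sigma v).2) su2).
have [others|] /= := boolP [forall v, (v != u) ==> ~~ (sigma v).2]; last first.
  move=> /forallPn[v]; rewrite negb_imply negbK => /andP[vu sv2].
  rewrite (_ : [forall v, _] = false); last first.
    by apply/negbTE/forallPn; exists v; rewrite vu sv2 andbF.
  rewrite big1// => z _; apply/eqP; rewrite eqb0.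
  by apply/forallPn; exists v; rewrite vu sv2 andbF.
(* With nobody else at the second level, the tests on that level drop out; what remains says that
   the first-level load is 0 or 1, that is, at most 1. *)
have drop (g : pred 'I_M) : [forall v, (v != u) ==> (g v && ~~ (sigma v).2)] =
    [forall v, (v != u) ==> g v].
  apply: eq_forallb => v; have := forallP others v.
  by case: (v != u) => //= ->; rewrite andbT.
rewrite (drop (fun v => ~~ (sigma v).1)).
under eq_bigr do rewrite (drop (fun v => (sigma v).1 == (v == _))).
rewrite -(card_eq0_others (f := fun v => (sigma v).1))//.
rewrite -(card_eq1_others (f := fun v => (sigma v).1))//.
by case: (#|_|) => [|[|k]].
Qed.

Section noma_weights.
Variables (R : realType) (m : nat) (u : 'I_m.+1) (weight : bool * bool -> R).
Hypothesis weight11 : weight (true, true) = 0.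
Hypothesis sum_weight1 : \sum_s weight s = 1.

Notation law := (fun A : pred (bool * bool) => \sum_(s | A s) weight s).
Notation a := (weight (true, false)).
Notation b := (weight (false, true)).

Let lawE (A : pred (bool * bool)) : law A = (if A (true, false) then a else 0) +
  (if A (false, true) then b else 0) +
  (if A (false, false) then weight (false, false) else 0).
Proof.
pose F x y := if A (x, y) then weight (x, y) else 0.
rewrite /= big_mkcond (eq_bigr (fun s => F s.1 s.2)); last by case.
rewrite -(pair_bigA _ F) /F.
rewrite !big_bool/= weight11 if_same add0r.
by rewrite addrA.
Qed.

Let weight00 : weight (false, false) = 1 - a - b.
Proof.
by have := lawE predT; rewrite /= sum_weight1 => ->; ring.
Qed.

(** Each term of the decomposition constrains the users separately, so its weight is a product. In
    the third, u and z are singled out and m - 1 users stay silent; for m = 0 the factor m annuls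
    that term. *)
Lemma noma_event_weight :
  \sum_(sigma : {ffun 'I_m.+1 -> bool * bool} | noma_event u sigma)
    \prod_v weight (sigma v) =
  a * (1 - a) ^+ m + b * (1 - a - b) ^+ m +
  m%:R * (b * (a * (1 - a - b) ^+ m.-1)).
Proof.
rewrite big_mkcond/=.
rewrite (eq_bigr (fun sigma : {ffun 'I_m.+1 -> bool * bool} =>
    (noma_event u sigma : nat)%:R * \prod_v weight (sigma v))); last first.
  by move=> sigma _; case: ifP => _; rewrite ?mul1r ?mul0r.
under eq_bigr do rewrite noma_event_decomposition !natrD !mulrDl natr_sum mulr_suml.
rewrite !big_split/=.
have rect (A : 'I_m.+1 -> pred (bool * bool)) (D : pred {ffun 'I_m.+1 -> bool * bool}) :
    (forall sigma, D sigma = [forall v, A v (sigma v)]) ->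
    \sum_sigma (D sigma : nat)%:R * \prod_v weight (sigma v) = \prod_v law (A v).
  move=> DA; rewrite (bigA_distr_big_dep _ (fun v s => weight s)) [RHS]big_mkcond.
  apply: eq_bigr => sigma _.
  have -> : D sigma = (sigma \in family A) by rewrite DA; apply/forallP/familyP.
  by case: ifP => _; rewrite ?mul1r ?mul0r.
have forall_u (f : pred (bool * bool)) (g : 'I_m.+1 -> pred (bool * bool))
    (sigma : {ffun 'I_m.+1 -> bool * bool}) :
    f (sigma u) && [forall v, (v != u) ==> g v (sigma v)] =
    [forall v, (if v == u then f else g v) (sigma v)].
  apply/andP/forallP => [[fu /forallP h] v|h].
    by case: eqP => [->//|/eqP vu]; have := h v; rewrite vu.
  split; first by have := h u; rewrite eqxx.
  by apply/forallP => v; apply/implyP => vu; have := h v; rewrite (negbTE vu).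
have prod_u (f : pred (bool * bool)) (g : 'I_m.+1 -> pred (bool * bool)) :
    \prod_v law (if v == u then f else g v) = law f * \prod_(v | v != u) law (g v).
  rewrite (bigD1 u)//= eqxx; congr (_ * _); apply: eq_bigr => v vu.
  by rewrite (negbTE vu).
have cardu : #|[pred v : 'I_m.+1 | v != u]| = m by rewrite cardC1 card_ord.
congr (_ + _ + _).
- pose f (s : bool * bool) := s.1; pose g (v : 'I_m.+1) (s : bool * bool) := ~~ s.1.
  rewrite (rect (fun v => if v == u then f else g v)); last first.
    by move=> sigma; rewrite -forall_u.
  rewrite prod_u [X in _ * X](eq_bigr (fun=> 1 - a)) ?prodr_const ?cardu; last first.
    by move=> v _; rewrite lawE/= weight00; ring.
  by rewrite lawE/= !addr0.
- pose f (s : bool * bool) := ~~ s.1 && s.2.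
  pose g (v : 'I_m.+1) (s : bool * bool) := ~~ s.1 && ~~ s.2.
  rewrite (rect (fun v => if v == u then f else g v)); last first.
    by move=> sigma; rewrite -forall_u andbA.
  rewrite prod_u [X in _ * X](eq_bigr (fun=> 1 - a - b)) ?prodr_const ?cardu; last first.
    by move=> v _; rewrite lawE/= weight00; ring.
  by rewrite lawE/= add0r addr0.
- rewrite exchange_big/=.
  rewrite (eq_bigr (fun=> b * (a * (1 - a - b) ^+ m.-1))); last first.
    move=> z zu; pose f (s : bool * bool) := ~~ s.1 && s.2.
    pose g (v : 'I_m.+1) (s : bool * bool) := (s.1 == (v == z)) && ~~ s.2.
    rewrite (rect (fun v => if v == u then f else g v)); last first.
      by move=> sigma; rewrite -forall_u andbA.
    rewrite prod_u (bigD1 z)//= [X in _ * (_ * X) = _](eq_bigr (fun=> 1 - a - b)); last first.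
      move=> v /andP[vu vz]; rewrite lawE /g /= (negbTE vz) /= weight00.
      by ring.
    rewrite prodr_const !lawE /g /= eqxx /= !add0r !addr0.
    congr (_ * (_ * _ ^+ _)).
    rewrite -[in RHS]cardu (cardD1 z [pred v | v != u]) inE zu add1n /=.
    by apply: eq_card => v; rewrite !inE andbC.
  by rewrite sumr_const cardu mulr_natl.
Qed.

End noma_weights.

Lemma noma_success_prob (R : realType) (m : nat) (P rate p : R) (u : 'I_m.+1)
    (a := p * (noma_availability m.+1 P rate true / 2))
    (b := p * (noma_availability m.+1 P rate false / 2)) : 0 <= p <= 1 ->
  success_prob p (noma_symbol m.+1 P rate) (noma_event u) =
  a * (1 - a) ^+ m + b * (1 - a - b) ^+ m +
  m%:R * (b * (a * (1 - a - b) ^+ m.-1)).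
Proof.
move=> p01; pose w s := fine (draw_law p [set x | noma_symbol m.+1 P rate x = s]).
have excl x : noma_symbol m.+1 P rate x != (true, true).
  rewrite /noma_symbol /transmits_at; case: (level x);
    by rewrite /= ?andbF ?andFb xpair_eqE/= ?andbF.
have w11 : w (true, true) = 0.
  rewrite /w (_ : [set x | _] = set0) ?measure0//; apply/seteqP; split => // x /= h.
  by have := excl x; rewrite h eqxx.
have w1 : \sum_s w s = 1 by apply: sum_weight; exact: measurable_noma_symbol.
have ea : [set x | noma_symbol m.+1 P rate x = (true, false)] =
    [set x | transmits_at m.+1 P rate true x].
  apply/seteqP; split => x /= h; first by case: h.
  have := excl x; rewrite /noma_symbol h.
  by case: (transmits_at _ _ _ false x).
have eb : [set x | noma_symbol m.+1 P rate x = (false, true)] =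
    [set x | transmits_at m.+1 P rate false x].
  apply/seteqP; split => x /= h; first by case: h.
  have := excl x; rewrite /noma_symbol h.
  by case: (transmits_at _ _ _ true x).
have wa : w (true, false) = a by rewrite /w ea; exact: draw_law_transmits_at.
have wb : w (false, true) = b by rewrite /w eb; exact: draw_law_transmits_at.
by rewrite /success_prob -wa -wb; exact: noma_event_weight.
Qed.

(** * Average AoI and the optimal attempt probability *)

(** The value +oo is the almost sure limit when no update ever arrives. Monotonicity in q turns AoI
    minimization into maximization of the success probability. *)
Definition aoi_value (R : realType) (T q : R) : \bar R :=
  if 0 < q then (T * (q^-1 + 2^-1))%:E else +oo%E.

Lemma le_aoi_value (R : realType) (T q r : R) : 0 < T -> q <= r ->
  (aoi_value T r <= aoi_value T q)%E.
Proof.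
move=> T0 qr; rewrite /aoi_value; case: ifPn => r0; case: ifPn => q0.
- by rewrite lee_fin ler_pM2l// lerD2r lef_pV2.
- by rewrite leey.
- by move: r0; rewrite (lt_le_trans q0 qr).
- exact: lexx.
Qed.

Lemma average_aoi_success_prob (R : realType) M (s : scheme) (T rate P p : R)
    (X : access_model M p) (u : 'I_M) (S : finType) (symbol : draw R -> S)
    (event : {ffun 'I_M -> S} -> bool) :
  0 < T -> (forall s, measurable [set x | symbol x = s]) ->
  (forall n w, delivered s rate P u n w =
    event [ffun v => symbol (draws X (v, n) w)]) ->
  average_aoi s T rate P X u (aoi_value T (success_prob p symbol event)).
Proof.
move=> T0 msym devent; set q := success_prob _ _ _.
pose B n w := delivered (X := X) s rate P u n w.
have BE : B = fun n w => event [ffun v => symbol (draws X (v, n) w)].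
  by apply/funext => n; apply/funext => w; exact: devent.
have q01 : 0 <= q <= 1 by exact: success_prob01.
have mB n : measurable [set w | B n w].
  by rewrite BE; exact: (@measurable_success R M p X S symbol msym event n).
have law N (c : nat -> bool) :
    Pr X [set w | forall n, (n < N)%N -> B n w = c n] =
    (\prod_(n < N) (if c n then q else 1 - q))%:E.
  by rewrite BE; exact: (@success_law R M p X S symbol msym event N c).
rewrite /aoi_value; have [q0|q0] := ltP 0 q.
  have := age_sum_square_cvg mB q01 law q0; apply: filterS => w hw.
  have := @average_age_cvg R T (B^~ w) T0 q^-1 hw.
  by move=> h; apply: cvg_EFin; [exact: nearW|exact: h].
have qE : q = 0 by apply/eqP; rewrite eq_le q0; case/andP: q01.
have := no_success_ae mB law qE; apply: filterS => w hw.
exact: (@average_age_cvgy R T (B^~ w) hw).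
Qed.

Section high_snr.
Variables (R : realType) (m : nat) (s : scheme) (T rate : R).
Variables (X : forall p : R, access_model m p) (u : 'I_m).
Variables (q : R -> R -> R) (f e : R -> R) (pmax : R).
Hypothesis T_gt0 : 0 < T.
Hypothesis q_aoi : forall P p, 0 < P -> 0 < p <= 1 ->
  average_aoi s T rate P (X p) u (aoi_value T (q P p)).
Hypothesis q_cont : forall P, continuous (q P).
Hypothesis q0 : forall P, q P 0 = 0.
Hypothesis q_ge0 : forall P p, 0 <= p <= 1 -> 0 <= q P p.
Hypothesis q_approx : forall P p, 0 <= p <= 1 -> `|q P p - f p| <= e P.
Hypothesis e_cvg : e P @[P --> +oo] --> (0 : R).
Hypothesis pmax01 : 0 <= pmax <= 1.
Hypothesis f_max : forall p, 0 <= p <= 1 -> f p <= f pmax.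
Hypothesis f_gt0 : 0 < f pmax.

Lemma high_snr_optimal :
  high_snr_optimal_aoi s T rate X u (T * ((f pmax)^-1 + 2^-1)).
Proof.
have /choice[popt popt_max] : forall P, exists p, 0 < p <= 1 /\
    forall p', 0 <= p' <= 1 -> q P p' <= q P p.
  move=> P; have [|c] := @EVT_max R (q P) 0 1 ler01.
    exact: (continuous_subspaceT (@q_cont P)).
  rewrite in_itv/= => /andP[c0 c1] cmax.
  have cmax' p : 0 <= p <= 1 -> q P p <= q P c by move=> p01; apply: cmax; rewrite in_itv.
  have [c_gt0|] := ltP 0 c; first by exists c; rewrite c_gt0.
  (* If the maximum is attained at 0 it equals 0, so [q P] vanishes on [0, 1] and p = 1 is optimal
     too; the excluded endpoint is thus avoided. *)
  move=> c_le0; have cE : c = 0 by apply/eqP; rewrite eq_le c_le0.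
  exists 1; rewrite ltr01 lexx; split => // p p01; apply: (le_trans (cmax' _ p01)).
  by rewrite cE q0 q_ge0// ler01 lexx.
have popt01 P : 0 <= popt P <= 1.
  by case: (popt_max P) => /andP[/ltW -> ->].
exists (fun P p => aoi_value T (q P p)), popt; split => //.
- move=> P _; case: (popt_max P) => h hmax; split => // p /andP[p0 p1].
  by apply: le_aoi_value => //; apply: hmax; rewrite (ltW p0).
- have qV : q P (popt P) @[P --> +oo] --> f pmax.
    apply/cvgrPdist_le => d d0.
    have /cvgrPdist_le /(_ _ d0) := e_cvg.
    apply: filterS => P; rewrite sub0r normrN => ed.
    apply: le_trans ed; apply: le_trans (ler_norm (e P)).
    (* With e for [e P]: f pmax - e <= q P pmax <= q P (popt P) <= f (popt P) + e <= f pmax + e.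
       Only the optimal values converge; nothing is claimed about the optimizers. *)
    have := q_approx P (popt01 P); have := q_approx P pmax01.
    have := f_max (popt01 P); have := (popt_max P).2 _ pmax01.
    by rewrite !ler_norml; lra.
  apply: (@cvg_trans _ ((T * ((q P (popt P))^-1 + 2^-1))%:E @[P --> +oo])).
    apply: near_eq_cvg; near=> P; rewrite /aoi_value ifT//.
    by near: P; apply: (cvgr_gt _ qV).
  apply: cvg_EFin; first exact: nearW.
  apply: cvgM; first exact: cvg_cst.
  by apply: cvgD; [apply: cvgV => //; rewrite gt_eqF|exact: cvg_cst].
Unshelve. all: by end_near. Qed.

End high_snr.

(** * Many users *)

Ltac nonzero := repeat (apply/andP; split);
  solve [by rewrite gt_eqF//; lra | by rewrite lt_eqF//; lra].

Section load_function.
Variable R : realType.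

Definition eta_fun (x : R) : R :=
  (1 - x / 2) * expR (- (x / 2)) + (1 - x ^+ 2 / 2) * expR (- x).

(* The limit of m times the NOMA success probability at p = x / m; its derivative
   is [eta_fun x / 2]. *)
Definition throughput (x : R) : R :=
  x / 2 * (expR (- (x / 2)) + expR (- x) * (1 + x / 2)).

Let scaled (x : R) : R := (1 - x / 2) * expR (x / 2) + 1 - x ^+ 2 / 2.

Let eta_funE x : eta_fun x = expR (- x) * scaled x.
Proof.
have e1 : expR (- (x / 2)) = expR (- x) * expR (x / 2).
  by rewrite -expRD; congr expR; field.
by rewrite /eta_fun /scaled e1; ring.
Qed.

Let scaled_decr x y : 0 <= x -> x < y -> scaled y < scaled x.
Proof.
move=> x0 xy; rewrite /scaled.
have sq : x ^+ 2 < y ^+ 2 by rewrite ltr_pXn2r ?nnegrE// (le_trans x0 (ltW xy)).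
(* Strictness comes from the quadratic term; (1 - h) e^h need only be nonincreasing for h >= 0. *)
suff : (1 - y / 2) * expR (y / 2) <= (1 - x / 2) * expR (x / 2) by lra.
pose d := y / 2 - x / 2; have d0 : 0 < d by rewrite /d; lra.
have -> : y / 2 = x / 2 + d by rewrite /d; ring.
rewrite expRD mulrCA mulrC [in leRHS]mulrC [in leRHS]mulrC ler_pM2r ?expR_gt0//.
(* With h = x / 2 the claim is (1 - h - d) e^d <= 1 - h. For h <= 1, use 1 - h - d <= (1 - h) (1 -
   d) and 1 - d <= e^(-d); for h > 1 the left side is negative and e^d >= 1 + d suffices. *)
have [x1|x1] := leP (x / 2) 1.
  rewrite -ler_pdivlMr ?expR_gt0// -expRN.
  have := expR_ge1Dx (- d) => ed.
  have x20 : 0 <= x / 2 by lra.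
  apply: (@le_trans _ _ ((1 - x / 2) * (1 - d))); first by nra.
  by rewrite ler_wpM2l//; lra.
have := expR_ge1Dx d => ed; nra.
Qed.

Lemma eta_fun_inj x y : 0 <= x -> 0 <= y -> eta_fun x = 0 -> eta_fun y = 0 -> x = y.
Proof.
move=> x0 y0; rewrite !eta_funE => /eqP; rewrite mulf_eq0 gt_eqF ?expR_gt0//= => /eqP sx.
move=> /eqP; rewrite mulf_eq0 gt_eqF ?expR_gt0//= => /eqP sy.
have [xy|yx|//] := ltgtP x y.
  by have := scaled_decr x0 xy; rewrite sx sy ltxx.
by have := scaled_decr y0 yx; rewrite sx sy ltxx.
Qed.

Let eta_fun_gt0 x y : 0 <= x -> x < y -> eta_fun y = 0 -> 0 < eta_fun x.
Proof.
move=> x0 xy; rewrite !eta_funE => /eqP; rewrite mulf_eq0 gt_eqF ?expR_gt0//= => /eqP sy.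
by rewrite mulr_gt0 ?expR_gt0// -sy scaled_decr.
Qed.

Let eta_fun_lt0 x y : 0 <= y -> y < x -> eta_fun y = 0 -> eta_fun x < 0.
Proof.
move=> x0 xy; rewrite !eta_funE => /eqP; rewrite mulf_eq0 gt_eqF ?expR_gt0//= => /eqP sy.
by rewrite pmulr_rlt0 ?expR_gt0// -sy scaled_decr.
Qed.

Let is_derive_expRN c (x : R) : is_derive x 1 (fun x => expR (c * x)) (c * expR (c * x)).
Proof.
apply: is_derive_eq; rewrite /GRing.scale /= ?mulr1 ?mulr0 ?addr0; ring.
Qed.

Lemma is_derive_throughput (x : R) : is_derive x 1 throughput (eta_fun x / 2).
Proof.
have -> : throughput = fun x => x / 2 * (expR (- 2^-1 * x) + expR (- 1 * x) * (1 + x / 2)).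
  by apply/funext => y; rewrite /throughput mulN1r mulNr [2^-1 * _]mulrC.
have h1 := is_derive_expRN (- 2^-1) x; have h2 := is_derive_expRN (- 1) x.
apply: is_derive_eq.
have e1 : expR (- 2^-1 * x) = expR (- (x / 2)) by congr expR; ring.
have e2 : expR (- 1 * x) = expR (- x) by congr expR; ring.
by rewrite e1 e2 /GRing.scale /= /eta_fun; field.
Qed.

Lemma continuous_throughput : continuous throughput.
Proof.
move=> x; apply: differentiable_continuous; apply/derivable1_diffP.
by case: (is_derive_throughput x).
Qed.

Lemma continuous_eta_fun : continuous eta_fun.
Proof.
have ce : continuous (fun x : R => expR (- x)).
  by move=> x; apply: continuous_comp; [exact: continuousN|exact: continuous_expR].
have ch : continuous (fun x : R => x / 2).
  by move=> x; apply: cvgM; [exact: cvg_id|exact: cvg_cst].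
have ceh : continuous (fun x : R => expR (- (x / 2))).
  move=> x.
  apply: (@continuous_comp _ _ _ (fun x : R => x / 2) (fun x => expR (- x))).
    exact: ch.
  exact: ce.
move=> x; apply: cvgD; apply: cvgM; [|exact: ceh| |exact: ce]; apply: cvgB.
- exact: cvg_cst.
- exact: ch.
- exact: cvg_cst.
- by apply: cvgM; [exact: exprn_continuous|exact: cvg_cst].
Qed.

Lemma throughput_max eta x : 0 < eta -> eta_fun eta = 0 -> 0 <= x ->
  throughput x <= throughput eta.
Proof.
move=> eta0 etaE x0.
have dt y : derivable throughput y 1 by case: (is_derive_throughput y).
have dtE y : derive1 throughput y = eta_fun y / 2.
  by rewrite derive1E; case: (is_derive_throughput y).
have ct (A : set R) : {within A, continuous throughput}.
  by apply: continuous_subspaceT => y; exact: continuous_throughput.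
have [xe|ex] := leP x eta.
  apply: (@ger0_derive1_le_cc _ throughput 0 eta) => //.
  - move=> y; rewrite in_itv/= => /andP[y0 ye]; rewrite dtE divr_ge0// ltW//.
    exact: (eta_fun_gt0 (ltW y0) ye).
  - by rewrite in_itv/= x0.
  - by rewrite in_itv/= lexx ltW.
apply: (@ler0_derive1_le_cc _ throughput eta x) => //.
- move=> y; rewrite in_itv/= => /andP[ey yx]; rewrite dtE.
  rewrite ler_pdivrMr// mul0r ltW//; exact: (eta_fun_lt0 (ltW eta0) ey).
- by rewrite in_itv/= lexx ltW.
- by rewrite in_itv/= lexx ltW.
- exact: ltW.
Qed.

Lemma eta_fun_root : exists2 eta : R, 0 < eta & eta_fun eta = 0.
Proof.
have e0 : eta_fun 0 = 2.
  by rewrite /eta_fun mul0r oppr0 expR0 expr0n/= mul0r subr0; ring.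
(* At 2 the exponential term of [scaled] vanishes and 1 - 2^2 / 2 = -1 remains, so [0, 2] brackets
   the root. *)
have e2 : eta_fun 2 < 0.
  rewrite eta_funE pmulr_rlt0 ?expR_gt0// /scaled divff// subrr mul0r add0r.
  by rewrite expr2 -mulrA divff// mulr1; lra.
have le0 : eta_fun 2 <= eta_fun 0 by rewrite e0; apply: le_trans (ltW e2) _.
have [|eta] := @IVT R eta_fun 0 2 0 (ler0n _ 2) (continuous_subspaceT continuous_eta_fun).
  by rewrite min_r// max_l// e0 (ltW e2)/=.
rewrite in_itv/= => /andP[eta0 _] etaE; exists eta => //.
rewrite lt_neqAle eta0 andbT; apply/eqP => e; move: etaE; rewrite -e e0 => /eqP.
by rewrite pnatr_eq0.
Qed.

Lemma throughput_gt0 x : 0 < x -> 0 < throughput x.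
Proof.
move=> x0; rewrite mulr_gt0//; first lra.
by rewrite addr_gt0 ?expR_gt0// mulr_gt0 ?expR_gt0//; lra.
Qed.

End load_function.

(** * Explicit bounds for finitely many users *)

Section finite_users.
Variable R : realType.

(* Success probabilities of a user with m competitors when no channel is ever in
   outage, that is, at infinite SNR. *)
Definition oma_throughput (m : nat) (p : R) : R := p * (1 - p) ^+ m.

Definition noma_throughput (m : nat) (p : R) : R :=
  p / 2 * (1 - p / 2) ^+ m + p / 2 * (1 - p) ^+ m +
  m%:R * (p / 2 * (p / 2 * (1 - p) ^+ m.-1)).

Lemma le_onem_exp_expR (x : R) n : x <= 1 -> (1 - x) ^+ n <= expR (- (n%:R * x)).
Proof.
move=> x1; rewrite -mulrN expRM_natl.
rewrite lerXn2r ?nnegrE ?subr_ge0 ?expR_ge0//.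
exact: expR_ge1Dx.
Qed.

(** Because 1 / (1 - x) = 1 + x / (1 - x) <= e^(x / (1 - x)). *)
Lemma ge_onem_exp_expR (x : R) n : x < 1 -> expR (- (n%:R * (x / (1 - x)))) <= (1 - x) ^+ n.
Proof.
move=> x1; have x10 : 0 < 1 - x by rewrite subr_gt0.
rewrite -mulrN expRM_natl lerXn2r ?nnegrE ?expR_ge0 ?(ltW x10)//.
rewrite expRN invf_ple ?posrE ?expR_gt0//.
apply: le_trans (expR_ge1Dx _); rewrite le_eqVlt; apply/orP; left; apply/eqP.
by field; nonzero.
Qed.

Lemma oma_throughput_le m p : (0 < m)%N -> 0 <= p <= 1 ->
  m%:R * oma_throughput m p <= expR (- 1).
Proof.
move=> m0 /andP[p0 p1]; rewrite /oma_throughput mulrA.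
apply: (@le_trans _ _ (m%:R * p * expR (- (m%:R * p)))).
  by rewrite ler_wpM2l ?mulr_ge0// le_onem_exp_expR.
(* With y = m p, the inequality y <= e^(y - 1) gives y e^(-y) <= e^(-1). *)
have := expR_ge1Dx (m%:R * p - 1); rewrite addrC subrK.
move=> h; apply: le_trans (ler_wpM2r (expR_ge0 _) h) _.
by rewrite -expRD addrAC subrr add0r.
Qed.

(** p = 1 / (m + 1) maximizes p (1 - p)^m. For m >= 1 it satisfies m p / (1 - p) = 1, so the
    exponential lower bound is exactly e^(-1); for m = 0 it is p = 1, where that bound does not
    apply. *)
Lemma oma_throughput_ge m :
  expR (- 1) / m.+1%:R <= oma_throughput m (m.+1%:R^-1).
Proof.
rewrite /oma_throughput mulrC ler_wpM2l ?invr_ge0//.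
case: m => [|m].
  by rewrite expr0 -[leRHS]expR0 ler_expR; lra.
apply: le_trans (ge_onem_exp_expR m.+1 _); last by rewrite invf_lt1 ?ltr1n ?ltr0n.
rewrite ler_expR le_eqVlt; apply/orP; left; apply/eqP.
rewrite -(natr1 m.+1); have : (0 : R) < m.+1%:R by rewrite ltr0n.
by move: m.+1%:R => x x0; field; nonzero.
Qed.

Lemma noma_throughput_le m p eta : 0 < eta -> eta_fun eta = 0 -> 0 <= p <= 1 ->
  m.+1%:R * noma_throughput m.+2 p <= m.+2%:R / m.+1%:R * throughput eta.
Proof.
move=> eta0 etaE /andP[p0 p1].
(* with m + 2 competitors, x = (m + 1) p turns (1 - p)^(m + 1) into at most e^(-x) *)
pose x := m.+1%:R * p; have x0 : 0 <= x by rewrite mulr_ge0.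
have r1 : 1 <= m.+2%:R / m.+1%:R :> R by rewrite ler_pdivlMr ?ltr0n// mul1r ler_nat.
apply: (@le_trans _ _ (m.+2%:R / m.+1%:R * throughput x)); last first.
  rewrite ler_wpM2l ?(le_trans _ r1)//; exact: throughput_max.
have m0 : (0 : R) < m.+1%:R by rewrite ltr0n.
have -> : m.+1%:R * noma_throughput m.+2 p = x / 2 * ((1 - p / 2) ^+ m.+2 +
    (1 - p) ^+ m.+2 + m.+2%:R / m.+1%:R * (x / 2) * (1 - p) ^+ m.+1).
  rewrite /noma_throughput /x /=; move: (_ ^+ _) (_ ^+ _) (_ ^+ _) => a b c.
  by move: m.+1%:R m.+2%:R m0 => y z y0; field; nonzero.
rewrite /throughput [leRHS]mulrCA ler_wpM2l//; first by rewrite divr_ge0.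
have h1 : (1 - p / 2) ^+ m.+2 <= expR (- (x / 2)).
  apply: (@le_trans _ _ ((1 - p / 2) ^+ m.+1)).
    by rewrite exprS ler_piMl ?exprn_ge0//; lra.
  by rewrite /x -mulrA; apply: le_onem_exp_expR; lra.
have h2 : (1 - p) ^+ m.+1 <= expR (- x) by exact: le_onem_exp_expR.
have h3 : (1 - p) ^+ m.+2 <= expR (- x).
  by apply: le_trans h2; rewrite exprS ler_piMl ?exprn_ge0//; lra.
move: (m.+2%:R / m.+1%:R) r1 h1 h2 h3 => r r1.
move: (expR_ge0 (- (x / 2))) (expR_ge0 (- x)) => e1 e2 h1 h2 h3.
(* Only the third term carries r = (m + 2) / (m + 1); since r >= 1, the other two are enlarged by it
   to reach a multiple of [throughput x]. *)
apply: (@le_trans _ _ (expR (- (x / 2)) + expR (- x) + r * (x / 2) * expR (- x))).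
  by apply: lerD; [exact: lerD|rewrite ler_wpM2l// mulr_ge0 ?divr_ge0//; lra].
by nra.
Qed.

Lemma noma_throughput_ge m (eta : R) : 0 < eta ->
  m.+1%:R / (m.+1%:R + eta) ^+ 2 * throughput eta <=
  noma_throughput m.+1 (eta / (m.+1%:R + eta)).
Proof.
(* this p satisfies (m + 1) p / (1 - p) = eta *)
move=> eta0; set p := eta / _.
have n0 : (0 : R) < m.+1%:R by rewrite ltr0n.
have s0 : 0 < m.+1%:R + eta by rewrite addr_gt0.
have p0 : 0 < p by rewrite divr_gt0.
have load1 (N : R) : 0 < N -> N * ((eta / (N + eta)) / (1 - eta / (N + eta))) = eta.
  by move=> N0; field; nonzero.
have load2 (N : R) : 0 < N -> N * ((eta / (N + eta) / 2) / (1 - eta / (N + eta) / 2)) =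
    N * eta / (2 * N + eta).
  by move=> N0; field; nonzero.
have p1 : p < 1 by rewrite ltr_pdivrMr// mul1r ltrDr.
have h2 : expR (- eta) <= (1 - p) ^+ m.+1.
  apply: le_trans (ge_onem_exp_expR m.+1 p1); rewrite ler_expR le_eqVlt; apply/orP; left.
  by rewrite /p load1.
have h1 : expR (- (eta / 2)) <= (1 - p / 2) ^+ m.+1.
  have p21 : p / 2 < 1 by lra.
  apply: le_trans (ge_onem_exp_expR m.+1 p21); rewrite ler_expR lerN2.
  (* The same p keeps the halved load below its limit: N eta / (2 N + eta) <= eta / 2 with N = m +
     1. *)
  rewrite (_ : m.+1%:R * _ = m.+1%:R * eta / (2 * m.+1%:R + eta)).
    rewrite ler_pdivrMr; last lra.
    by have := sqr_ge0 eta; rewrite expr2; nra.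
  exact: load2.
have h3 : expR (- eta) <= (1 - p) ^+ m.
  by apply: le_trans h2 _; rewrite exprS ler_piMl ?exprn_ge0//; lra.
rewrite /noma_throughput /=.
apply: (@le_trans _ _ (p / 2 * (expR (- (eta / 2)) + expR (- eta) +
    m.+1%:R * (p / 2) * expR (- eta)))); last first.
  rewrite -mulrDr [_ * (_ * (_ * _))]mulrCA -mulrDr ler_wpM2l//; first lra.
  apply: lerD; first exact: lerD.
  by rewrite -mulrA ler_wpM2l// ler_wpM2l//; lra.
(* In the third term (m + 1) p = r eta with r < 1. Giving up r on the first two terms as well leaves
   exactly r times the bracket of [throughput eta]. *)
rewrite /throughput /p; set r := m.+1%:R / (m.+1%:R + eta).
have r1 : 0 < r <= 1.
  by rewrite /r divr_gt0//= ler_pdivrMr// mul1r lerDl ltW.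
rewrite (_ : m.+1%:R / (m.+1%:R + eta) ^+ 2 * _ = eta / (m.+1%:R + eta) / 2 *
    (r * expR (- (eta / 2)) + r * expR (- eta) + r * (eta / 2) * expR (- eta))); last first.
  by rewrite /r; move: m.+1%:R n0 s0 => N n0 s0; field; nonzero.
rewrite ler_wpM2l//; first by rewrite divr_ge0// divr_ge0// ltW.
rewrite (_ : m.+1%:R * (eta / (m.+1%:R + eta) / 2) = r * (eta / 2)); last first.
  by rewrite /r; move: m.+1%:R n0 s0 => N n0 s0; field; nonzero.
by case/andP: r1 => r0 r1; rewrite !lerD// ler_piMl ?expR_ge0.
Qed.

End finite_users.

Section ratio.
Variable R : realType.

Lemma cvg_onep_harmonic_inv (c : R) :
  (1 + c * @harmonic R k)^-1 @[k --> \oo] --> (1 : R).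
Proof.
rewrite -[X in _ --> X]invr1; apply: cvgV; first exact: oner_neq0.
rewrite -[X in _ --> X]addr0 -[X in _ + X](mulr0 c).
apply: cvgD; first exact: cvg_cst.
by apply: cvgM; [exact: cvg_cst|exact: cvg_harmonic].
Qed.

Lemma cvg_natr_oma (f : nat -> R) :
  (forall m, expR (- 1) / m.+1%:R <= f m) ->
  (forall m, (0 < m)%N -> m%:R * f m <= expR (- 1)) ->
  m.+1%:R * f m.+1 @[m --> \oo] --> expR (- 1).
Proof.
move=> low upp.
have h : (1 + 1 * @harmonic R k)^-1 * expR (- 1) @[k --> \oo] --> (1 * expR (- 1) : R).
  by apply: cvgM; [exact: cvg_onep_harmonic_inv|exact: cvg_cst].
rewrite mul1r in h; apply: (squeeze_cvgr _ h (cvg_cst _)).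
apply: nearW => m; rewrite upp// andbT.
apply: le_trans (ler_wpM2l _ (low m.+1)); last by [].
rewrite /harmonic /= mul1r -(natr1 m.+1) le_eqVlt; apply/orP; left; apply/eqP.
have : (0 : R) < m.+1%:R by rewrite ltr0n.
by move: m.+1%:R => x x0; field; nonzero.
Qed.

(** Multiplied by m + 1, the bounds become (1 + c / (m + 1))^(-2) [phi], with c = [eta] below and c
    = -1 above. The upper one starts at m = 1, its denominator being 0 at m = 0. *)
Lemma cvg_natr_noma (f : nat -> R) (eta phi : R) : 0 < eta -> 0 < phi ->
  (forall m, m.+1%:R / (m.+1%:R + eta) ^+ 2 * phi <= f m.+1) ->
  (forall m, m.+1%:R * f m.+2 <= m.+2%:R / m.+1%:R * phi) ->
  m.+1%:R * f m.+1 @[m --> \oo] --> phi.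
Proof.
move=> eta0 phi0 low upp.
have h c : (1 + c * @harmonic R k)^-1 * (1 + c * @harmonic R k)^-1 * phi
    @[k --> \oo] --> (1 * 1 * phi : R).
  by apply: cvgM; [apply: cvgM; exact: cvg_onep_harmonic_inv|exact: cvg_cst].
have hl := h eta; have hu := h (- 1); rewrite !mul1r in hl hu.
have ub m : (0 < m)%N -> m.+1%:R * f m.+1 <=
    (1 + - 1 * @harmonic R m)^-1 * (1 + - 1 * @harmonic R m)^-1 * phi.
  case: m => // m _; have := upp m.
  rewrite /harmonic /= -(natr1 m.+1); move: (f m.+2) => y.
  have : (0 : R) < m.+1%:R by rewrite ltr0n.
  move: m.+1%:R => x x0; rewrite -ler_pdivlMl// => yle.
  apply: le_trans (ler_wpM2l _ yle) _; first lra.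
  rewrite le_eqVlt; apply/orP; left; apply/eqP.
  by field; nonzero.
apply: (squeeze_cvgr _ hl hu); near=> m; apply/andP; split.
  apply: le_trans (ler_wpM2l _ (low m)); last by [].
  rewrite /harmonic /= le_eqVlt; apply/orP; left; apply/eqP.
  have : (0 : R) < m.+1%:R by rewrite ltr0n.
  by move: m.+1%:R => x x0; field; nonzero.
by apply: ub; near: m; exact: nbhs_infty_gt.
Unshelve. all: by end_near. Qed.

(** Dividing numerator and denominator by T (m + 1) makes the half-slot terms 1/2 disappear in the
    limit. *)
Lemma cvg_aoi_ratio (T a b : R) (f g : nat -> R) : 0 < T -> 0 < a -> 0 < b ->
  (forall m, 0 < f m) -> (forall m, 0 < g m) ->
  m.+1%:R * f m.+1 @[m --> \oo] --> a -> m.+1%:R * g m.+1 @[m --> \oo] --> b ->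
  (T * ((f m.+1)^-1 + 2^-1)) / (T * ((g m.+1)^-1 + 2^-1)) @[m --> \oo] --> b / a.
Proof.
move=> T0 a0 b0 f0 g0 fa gb.
have key (c : R) (h : nat -> R) : 0 < c -> m.+1%:R * h m.+1 @[m --> \oo] --> c ->
    (m.+1%:R * h m.+1)^-1 + 2^-1 * @harmonic R m @[m --> \oo] --> c^-1.
  move=> c0 hc; rewrite -[X in _ --> X]addr0 -[X in _ + X](mulr0 2^-1).
  apply: cvgD; first by apply: cvgV => //; rewrite gt_eqF.
  by apply: cvgM; [exact: cvg_cst|exact: cvg_harmonic].
have -> : b / a = a^-1 * (b^-1)^-1 by rewrite invrK mulrC.
rewrite (_ : (fun m => _) = (fun m => ((m.+1%:R * f m.+1)^-1 + 2^-1 * @harmonic R m) *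
    ((m.+1%:R * g m.+1)^-1 + 2^-1 * @harmonic R m)^-1)).
  apply: cvgM; first exact: key.
  by apply: cvgV; [rewrite invr_eq0 gt_eqF|exact: key].
apply/funext => m; rewrite /harmonic /=.
have : (0 : R) < m.+1%:R by rewrite ltr0n.
move: (f m.+1) (f0 m.+1) (g m.+1) (g0 m.+1) m.+1%:R => x x0 y y0 z z0.
have u : 0 < 2 + y by lra.
by field; nonzero.
Qed.

End ratio.

(** * The high-SNR limit *)

(** Zero gain is the one case that no transmit power can rescue. It is the origin, a null point
    because the normal law is absolutely continuous. *)
Lemma fading_law_gain_eq0 (R : realType) : fading_law R [set z | gain z = 0] = 0%E.
Proof.
have -> : [set z | @gain R z = 0] = [set 0] `*` [set 0].
  apply/seteqP; split => -[x y] /=; rewrite /gain /=.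
    move/eqP; rewrite paddr_eq0 ?sqr_ge0// !sqrf_eq0.
    by case/andP => /eqP -> /eqP ->.
  by case=> -> ->; rewrite expr0n addr0.
pose N := normal_prob 0 (Num.sqrt (2^-1 : R)) [set 0].
have N0 : N = 0%E.
  have /null_content_dominatesP dom := normal_prob_dominates 0 (Num.sqrt (2^-1 : R)).
  by apply: dom; [exact: measurable_set1|exact: lebesgue_measure_set1].
transitivity (N * N)%E; first exact: product_measure1E.
by rewrite N0 mule0.
Qed.

Lemma gain_ge0 (R : realType) z : 0 <= @gain R z.
Proof. by rewrite addr_ge0 ?sqr_ge0. Qed.

Lemma dist1_le (R : realType) (x y d : R) :
  x <= y -> y <= 1 -> `|1 - x| <= d -> `|1 - y| <= d.
Proof. by move=> xy y1; rewrite !ger0_norm; lra. Qed.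

(** Continuity along increasing sets handles integer P, and monotonicity in P the rest. The
    exponential law of the gain is never computed; having no atom at 0 is enough. *)
Lemma availability_cvg1 (R : realType) (theta : R) :
  fine (fading_law R [set z | theta <= P * gain z]) @[P --> +oo] --> (1 : R).
Proof.
pose F n : set (measurableTypeR R * measurableTypeR R) := [set z | theta <= n%:R * gain z].
have mF n : measurable (F n) by exact: measurable_gain_ge.
have mU : measurable (\bigcup_n F n) by exact: bigcup_measurable.
have FU : fading_law R (\bigcup_n F n) = 1%E.
  apply/eqP; rewrite eq_le probability_le1//=.
  have mg0 : measurable [set z | @gain R z = 0].
    have := @measurable_gain R measurableT _ (measurable_set1 0).
    by rewrite setTI; congr measurable; apply/seteqP.
  have <- : fading_law R (~` [set z | @gain R z = 0]) = 1%E.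
    by rewrite probability_setC// fading_law_gain_eq0 sube0.
  apply: le_measure; rewrite ?inE//; first exact: measurableC.
  move=> z /= /eqP gz; have g0 : 0 < gain z by rewrite lt_neqAle eq_sym gz gain_ge0.
  exists (Num.truncn (theta / gain z)).+1 => //; rewrite /F /=.
  by rewrite -ler_pdivrMr// ltW// truncnS_gt.
have cF : fading_law R (F n) @[n --> \oo] --> (1%:E : \bar R).
  rewrite -FU; apply: nondecreasing_cvg_mu => // i j ij; apply/subsetPset => z /= h.
  by apply: le_trans h _; rewrite ler_wpM2r ?gain_ge0// ler_nat.
have {}cF : fine (fading_law R (F n)) @[n --> \oo] --> (1 : R).
  by have /fine_cvg := cF.
apply/cvgrPdist_le => d d0; have /cvgrPdist_le /(_ _ d0) [N _ hN] := cF.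
have fin A : measurable A -> fading_law R A \is a fin_num by move=> mA; exact: fin_num_measure.
near=> P.
have mP : measurable [set z | theta <= P * @gain R z] by exact: measurable_gain_ge.
have le1 : fine (fading_law R [set z | theta <= P * gain z]) <= 1.
  by rewrite -lee_fin fineK; [exact: probability_le1|exact: fin].
apply: (dist1_le _ le1 (hN N (leqnn N))); apply: fine_le; [exact: fin|exact: fin|].
apply: le_measure; rewrite ?inE// => z /= h; apply: le_trans h _.
rewrite ler_wpM2r ?gain_ge0//; near: P; apply: nbhs_pinfty_ge; exact: num_real.
Unshelve. all: by end_near. Qed.

Lemma noma_availability_cvg1 (R : realType) M (rate : R) b :
  noma_availability M P rate b @[P --> +oo] --> (1 : R).
Proof. exact: availability_cvg1. Qed.

Lemma fading_fine_le1 (R : realType) (A : set (measurableTypeR R * measurableTypeR R)) :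
  measurable A -> 0 <= fine (fading_law R A) <= 1.
Proof.
move=> mA; apply/andP; split; first exact: fine_ge0.
rewrite -lee_fin fineK; first exact: probability_le1.
exact: (fin_num_measure (fading_law R)).
Qed.

Lemma noma_availability01 (R : realType) M (P rate : R) b :
  0 <= noma_availability M P rate b <= 1.
Proof. by apply: fading_fine_le1; exact: measurable_gain_ge. Qed.

Lemma oma_availability01 (R : realType) (P rate : R) :
  0 <= oma_availability P rate <= 1.
Proof. by apply: fading_fine_le1; exact: measurable_rate_gt. Qed.

Lemma oma_availability_cvg1 (R : realType) (rate : R) :
  oma_availability P rate @[P --> +oo] --> (1 : R).
Proof.
(* The threshold 2^rate, larger than the exact 2^rate - 1, yields the strict inequality of the
   no-outage condition at no cost in the limit. *)
apply: squeeze_cvgr; [|exact: (availability_cvg1 (2 `^ rate))|exact: cvg_cst].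
apply: nearW => P; apply/andP; split; last by case/andP: (oma_availability01 P rate).
have mA := measurable_gain_ge P (2 `^ rate); have mB := measurable_rate_gt P rate.
apply: fine_le; try exact: (fin_num_measure (fading_law R)).
apply: le_measure; rewrite ?inE//.
move=> z /= h; rewrite ltr_pdivlMr ?ln_gt0 ?ltr1n//.
have r0 : 0 < 2 `^ rate :> R by rewrite powR_gt0.
rewrite -ln_powR ltr_ln ?posrE//; first by rewrite (le_lt_trans h)// ltrDr.
by rewrite (lt_le_trans r0)// (le_trans h)// lerDr.
Qed.

(** * Approximation by infinite SNR, uniformly in the attempt probability *)

Section lipschitz.
Variable R : realType.
Implicit Types x y : R.

Lemma dist_mul_le x y x' y' : `|x| <= 1 -> `|y'| <= 1 ->
  `|x * y - x' * y'| <= `|x - x'| + `|y - y'|.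
Proof.
move=> x1 y1; rewrite (_ : _ - _ = (x - x') * y' + x * (y - y')); last by ring.
apply: le_trans (ler_normD _ _) _; rewrite !normrM.
by apply: lerD; [rewrite ler_piMr|rewrite ler_piMl].
Qed.

Lemma norm_exp_le1 x n : `|x| <= 1 -> `|x ^+ n| <= 1.
Proof. by move=> x1; rewrite normrX exprn_ile1. Qed.

Lemma dist_exp_le x y n : `|x| <= 1 -> `|y| <= 1 ->
  `|x ^+ n - y ^+ n| <= n%:R * `|x - y|.
Proof.
move=> x1 y1; elim: n => [|n IH]; first by rewrite subrr normr0 mul0r.
rewrite !exprS; apply: le_trans (dist_mul_le _ _ x1 (norm_exp_le1 _ y1)) _.
by rewrite -natr1 mulrDl mul1r addrC lerD2r.
Qed.

End lipschitz.

Definition noma_success_poly (R : realType) (m : nat) (a b : R) : R :=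
  a * (1 - a) ^+ m + b * (1 - a - b) ^+ m +
  m%:R * (b * (a * (1 - a - b) ^+ m.-1)).

(** Supplies the convergence in P that is uniform in p. Arguments at most 1/2 keep every factor,
    including 1 - a - b, in [0, 1]; the constant is 2 (m + 1) + m (m + 1). *)
Lemma noma_success_poly_lipschitz (R : realType) m (a b a' b' : R) :
  0 <= a <= 2^-1 -> 0 <= b <= 2^-1 -> 0 <= a' <= 2^-1 -> 0 <= b' <= 2^-1 ->
  `|noma_success_poly m a b - noma_success_poly m a' b'| <=
  (m.+1 * m.+2)%:R * (`|a - a'| + `|b - b'|).
Proof.
move=> a01 b01 a01' b01'; set D := `|a - a'| + `|b - b'|.
have D0 : 0 <= D by rewrite addr_ge0.
have Da : `|a - a'| <= D by rewrite lerDl.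
have Db : `|b - b'| <= D by rewrite lerDr.
have na : `|a| <= 1 by rewrite ler_norml; lra.
have nb : `|b| <= 1 by rewrite ler_norml; lra.
have na' : `|a'| <= 1 by rewrite ler_norml; lra.
have nb' : `|b'| <= 1 by rewrite ler_norml; lra.
have n1a : `|1 - a| <= 1 by rewrite ler_norml; lra.
have n1a' : `|1 - a'| <= 1 by rewrite ler_norml; lra.
have n1ab : `|1 - a - b| <= 1 by rewrite ler_norml; lra.
have n1ab' : `|1 - a' - b'| <= 1 by rewrite ler_norml; lra.
have d1 : `|(1 - a) - (1 - a')| <= D.
  by rewrite (_ : _ - _ = - (a - a')) ?normrN//; ring.
have d2 : `|(1 - a - b) - (1 - a' - b')| <= D.
  rewrite (_ : _ - _ = - ((a - a') + (b - b'))) ?normrN; last by ring.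
  exact: ler_normD.
have expD k (x y : R) : `|x| <= 1 -> `|y| <= 1 -> `|x - y| <= D ->
    `|x ^+ k - y ^+ k| <= k%:R * D.
  by move=> x1 y1 xy; apply: le_trans (dist_exp_le _ x1 y1) _; rewrite ler_wpM2l.
have t1 : `|a * (1 - a) ^+ m - a' * (1 - a') ^+ m| <= D + m%:R * D.
  apply: le_trans (dist_mul_le _ _ na (norm_exp_le1 _ n1a')) _.
  by apply: lerD => //; exact: expD.
have t2 : `|b * (1 - a - b) ^+ m - b' * (1 - a' - b') ^+ m| <= D + m%:R * D.
  apply: le_trans (dist_mul_le _ _ nb (norm_exp_le1 _ n1ab')) _.
  by apply: lerD => //; exact: expD.
have t3 : `|b * (a * (1 - a - b) ^+ m.-1) - b' * (a' * (1 - a' - b') ^+ m.-1)| <=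
    D + m%:R * D.
  apply: le_trans (dist_mul_le _ _ nb _) _.
    by rewrite normrM mulr_ile1// norm_exp_le1.
  apply: (@le_trans _ _ (`|b - b'| + (`|a - a'| + m.-1%:R * D))).
    rewrite lerD2l; apply: le_trans (dist_mul_le _ _ na (norm_exp_le1 _ n1ab')) _.
    by rewrite lerD2l; exact: expD.
  case: (m) => [|k] /=; last first.
    by rewrite -natr1 mulrDl mul1r addrA [X in X + _ <= _]addrC -/D lerD2l lerDl.
  by rewrite mul0r !addr0 /D addrC.
rewrite /noma_success_poly.
rewrite (_ : _ - _ = (a * (1 - a) ^+ m - a' * (1 - a') ^+ m) +
  (b * (1 - a - b) ^+ m - b' * (1 - a' - b') ^+ m) +
  m%:R * (b * (a * (1 - a - b) ^+ m.-1) - b' * (a' * (1 - a' - b') ^+ m.-1))); last by ring.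
apply: le_trans (ler_normD _ _) _; rewrite normrM (ger0_norm (ler0n _ m)).
have t3' := ler_wpM2l (ler0n R m) t3.
have t12 := le_trans (ler_normD _ _) (lerD t1 t2).
apply: le_trans (lerD t12 t3') _.
rewrite le_eqVlt; apply/orP; left; apply/eqP.
by rewrite natrM -!natr1; ring.
Qed.

Lemma continuous_exp_comp (R : realType) (g : R -> R) n :
  continuous g -> continuous (fun x => g x ^+ n).
Proof.
move=> cg x; elim: n => [|n IH]; first exact: cvg_cst.
rewrite (_ : (fun _ => _) = fun x => g x * g x ^+ n).
  exact: (@cvgM _ _ _ _ g (fun x => g x ^+ n) _ _ (cg x) IH).
by apply/funext => y; rewrite exprS.
Qed.

Lemma continuous_noma_success_poly (R : realType) m (c d : R) :
  continuous (fun p : R => noma_success_poly m (p * c) (p * d)).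
Proof.
have cM k : continuous (fun p : R => p * k).
  by move=> x; apply: cvgM; [exact: cvg_id|exact: cvg_cst].
have c1 k : continuous (fun p : R => 1 - p * k).
  by move=> x; apply: cvgB; [exact: cvg_cst|exact: cM].
have c2 : continuous (fun p : R => 1 - p * c - p * d).
  by move=> x; apply: cvgB; [exact: c1|exact: cM].
move=> x; rewrite /noma_success_poly; apply: cvgD; [apply: cvgD|].
- by apply: cvgM; [exact: cM|exact: (@continuous_exp_comp R (fun p => 1 - p * c) m (c1 c) x)].
- by apply: cvgM; [exact: cM|exact: (@continuous_exp_comp R (fun p => 1 - p * c - p * d) m c2 x)].
- apply: cvgM; [exact: cvg_cst|apply: cvgM; [exact: cM|]].
  by apply: cvgM; [exact: cM|exact: (@continuous_exp_comp R (fun p => 1 - p * c - p * d) m.-1 c2 x)].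
Qed.

Lemma continuous_oma_success (R : realType) m (c : R) :
  continuous (fun p : R => p * c * (1 - p) ^+ m).
Proof.
have c1 : continuous (fun p : R => 1 - p).
  by move=> x; apply: cvgB; [exact: cvg_cst|exact: cvg_id].
move=> x; apply: cvgM; last exact: (@continuous_exp_comp R (fun p => 1 - p) m c1 x).
by apply: cvgM; [exact: cvg_id|exact: cvg_cst].
Qed.

Lemma noma_throughputE (R : realType) m (p : R) :
  noma_throughput m p = noma_success_poly m (p * 2^-1) (p * 2^-1).
Proof.
by rewrite /noma_throughput /noma_success_poly (_ : 1 - p / 2 - p / 2 = 1 - p)//; field.
Qed.

Lemma unit_max (R : realType) (f : R -> R) : continuous f ->
  exists2 p, 0 <= p <= 1 & forall x, 0 <= x <= 1 -> f x <= f p.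
Proof.
move=> cf; have [p] := @EVT_max R f 0 1 ler01 (continuous_subspaceT cf).
rewrite in_itv/= => p01 fp; exists p => // x x01; apply: fp; by rewrite in_itv.
Qed.

Lemma noma_success_poly0 (R : realType) m (x y : R) :
  noma_success_poly m (0 * x) (0 * y) = 0.
Proof. by rewrite /noma_success_poly !mul0r mulr0 !addr0. Qed.

Section optimal_aoi.
Variables (R : realType) (T rate : R) (m : nat).
Hypothesis T_gt0 : 0 < T.
Variable X : forall p : R, access_model m.+1 p.

Lemma oma_optimal_aoi pmax : 0 <= pmax <= 1 ->
  (forall p, 0 <= p <= 1 -> oma_throughput m p <= oma_throughput m pmax) ->
  0 < oma_throughput m pmax ->
  high_snr_optimal_aoi OMA T rate X ord0 (T * ((oma_throughput m pmax)^-1 + 2^-1)).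
Proof.
move=> pmax01 hmax h0.
apply: (@high_snr_optimal R m.+1 OMA T rate X ord0
  (fun P p => p * oma_availability P rate * (1 - p) ^+ m) (oma_throughput m)
  (fun P => 1 - oma_availability P rate)) => //.
- move=> P p P0 /andP[p0 p1]; rewrite -(oma_success_prob P rate ord0) ?(ltW p0)//.
  apply: average_aoi_success_prob => //; first exact: measurable_oma_symbol.
  by move=> n w; exact: delivered_oma.
- by move=> P; exact: continuous_oma_success.
- by move=> P; rewrite !mul0r.
- move=> P p /andP[p0 p1]; rewrite mulr_ge0 ?exprn_ge0 ?subr_ge0// mulr_ge0//.
  by case/andP: (oma_availability01 P rate).
- move=> P p /andP[p0 p1]; rewrite /oma_throughput.
  have /andP[c0 c1] := oma_availability01 P rate.
  rewrite (_ : _ - _ = - ((p * (1 - p) ^+ m) * (1 - oma_availability P rate))); last by ring.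
  rewrite normrN normrM (@ger0_norm _ (1 - _)) ?subr_ge0// ler_piMl ?subr_ge0//.
  rewrite normrM mulr_ile1// ?ger0_norm// ?exprn_ge0 ?subr_ge0//.
  by rewrite exprn_ile1 ?subr_ge0//; lra.
- rewrite -[X in _ --> X](subrr 1); apply: cvgB; first exact: cvg_cst.
  exact: oma_availability_cvg1.
Qed.

Lemma noma_optimal_aoi pmax : 0 <= pmax <= 1 ->
  (forall p, 0 <= p <= 1 -> noma_throughput m p <= noma_throughput m pmax) ->
  0 < noma_throughput m pmax ->
  high_snr_optimal_aoi NOMA T rate X ord0 (T * ((noma_throughput m pmax)^-1 + 2^-1)).
Proof.
move=> pmax01 hmax h0.
pose c b P := noma_availability m.+1 P rate b.
have c01 b P : 0 <= c b P <= 1 by exact: noma_availability01.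
apply: (@high_snr_optimal R m.+1 NOMA T rate X ord0
  (fun P p => noma_success_poly m (p * (c true P / 2)) (p * (c false P / 2)))
  (noma_throughput m)
  (fun P => (m.+1 * m.+2)%:R * ((1 - c true P) + (1 - c false P)))) => //.
- move=> P p P0 /andP[p0 p1].
  rewrite /noma_success_poly -(noma_success_prob P rate ord0); last by rewrite (ltW p0).
  apply: average_aoi_success_prob => //; first exact: measurable_noma_symbol.
  by move=> n w; exact: delivered_noma.
- by move=> P; exact: continuous_noma_success_poly.
- by move=> P; exact: noma_success_poly0.
- move=> P p p01; have := c01 true P; have := c01 false P.
  move: (c true P) (c false P) => x y y01 x01.
  have a0 : 0 <= p * (x / 2) by nra.
  have b0 : 0 <= p * (y / 2) by nra.
  have ab : p * (x / 2) + p * (y / 2) <= 1 by nra.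
  by rewrite /noma_success_poly !addr_ge0 ?mulr_ge0 ?exprn_ge0//; lra.
- move=> P p p01; rewrite noma_throughputE.
  have := c01 true P; have := c01 false P.
  move: (c true P) (c false P) => x y y01 x01.
  apply: le_trans (noma_success_poly_lipschitz _ _ _ _ _) _; try by nra.
  rewrite ler_wpM2l//; apply: lerD; rewrite ler_norml; nra.
- rewrite -[X in _ --> X](mulr0 ((m.+1 * m.+2)%:R)); apply: cvgM; first exact: cvg_cst.
  rewrite -[X in _ --> X](addr0 0) -(subrr 1); apply: cvgD; apply: cvgB;
    try exact: cvg_cst; exact: noma_availability_cvg1.
Qed.

End optimal_aoi.

(* X m p models m + 1 users with attempt probability p; U_1 is ord0. *)
Theorem proposition1 (R : realType) (T rate : R) (T_gt0 : 0 < T)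
    (rate_gt0 : 0 < rate)
    (X : forall (m : nat) (p : R), @access_model R m.+1 p) :
  exists eta : R,
    [/\ 0 < eta,
        (1 - eta / 2) * expR (- (eta / 2)) +
          (1 - eta ^+ 2 / 2) * expR (- eta) = 0,
        forall x : R, 0 < x ->
          (1 - x / 2) * expR (- (x / 2)) + (1 - x ^+ 2 / 2) * expR (- x) = 0 ->
          x = eta
      & exists AoIN AoIO : nat -> R,
        [/\ forall m, high_snr_optimal_aoi NOMA T rate (X m) ord0 (AoIN m.+1),
            forall m, high_snr_optimal_aoi OMA T rate (X m) ord0 (AoIO m.+1)
          & AoIN M / AoIO M @[M --> \oo] -->
            2 * expR (eta - 1) / (eta * (expR (eta / 2) + 1 + eta / 2))]].
Proof.
have [eta eta0 etaE] := @eta_fun_root R.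
have /choice[pN pNP] : forall m, exists p : R, 0 <= p <= 1 /\
    forall x, 0 <= x <= 1 -> noma_throughput m x <= noma_throughput m p.
  move=> m; have [|p p01 h] := @unit_max R (noma_throughput m); last by exists p.
  rewrite (_ : noma_throughput m = fun p => noma_success_poly m (p * 2^-1) (p * 2^-1)).
    exact: continuous_noma_success_poly.
  by apply/funext => p; exact: noma_throughputE.
have /choice[pO pOP] : forall m, exists p : R, 0 <= p <= 1 /\
    forall x, 0 <= x <= 1 -> oma_throughput m x <= oma_throughput m p.
  move=> m; have [|p p01 h] := @unit_max R (oma_throughput m); last by exists p.
  rewrite (_ : oma_throughput m = fun p => p * 1 * (1 - p) ^+ m).
    exact: continuous_oma_success.
  by apply/funext => p; rewrite mulr1.
pose f m := noma_throughput m (pN m); pose g m := oma_throughput m (pO m).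
have eta01 m : 0 <= eta / (m.+1%:R + eta) <= 1.
  have n0 : (0 : R) < m.+1%:R by rewrite ltr0n.
  by rewrite divr_ge0 ?addr_ge0 ?(ltW eta0)//= ler_pdivrMr; lra.
have inv01 m : 0 <= (m.+1%:R^-1 : R) <= 1.
  by rewrite invr_ge0 ler0n/= invf_le1 ?ltr0n// ler1n.
have g_ge m : expR (- 1) / m.+1%:R <= g m.
  by apply: le_trans (oma_throughput_ge _ _) _; apply: (pOP m).2.
have f_ge m : m.+1%:R / (m.+1%:R + eta) ^+ 2 * throughput eta <= f m.+1.
  by apply: le_trans (noma_throughput_ge _ eta0) _; apply: (pNP m.+1).2.
have g0 m : 0 < g m.
  by apply: lt_le_trans (g_ge m); rewrite divr_gt0 ?expR_gt0 ?ltr0n.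
have phi0 := throughput_gt0 eta0.
have f0 m : 0 < f m.
  (* [f_ge] starts at one competitor; without competitors, p = 1 already succeeds with probability
     1. *)
  case: m => [|m]; last first.
    apply: lt_le_trans (f_ge m); rewrite mulr_gt0// divr_gt0 ?ltr0n// exprn_gt0//.
    by rewrite addr_gt0.
  apply: (@lt_le_trans _ _ (noma_throughput 0 1)); last first.
    by apply: (pNP 0%N).2; rewrite ler01 lexx.
  by rewrite /noma_throughput !expr0; lra.
have cf : m.+1%:R * f m.+1 @[m --> \oo] --> throughput eta.
  apply: (cvg_natr_noma eta0 phi0 f_ge) => m.
  by apply: noma_throughput_le => //; exact: (pNP _).1.
have cg : m.+1%:R * g m.+1 @[m --> \oo] --> expR (- 1 : R).
  apply: (cvg_natr_oma g_ge) => m m0.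
  by apply: oma_throughput_le => //; exact: (pOP _).1.
exists eta; split => //.
  by move=> x x0 xE; apply: eta_fun_inj; rewrite ?ltW.
(* M users mean M - 1 competitors; the values at M = 0 are arbitrary. *)
exists (fun M => T * ((f M.-1)^-1 + 2^-1)), (fun M => T * ((g M.-1)^-1 + 2^-1)); split.
- by move=> m; apply: noma_optimal_aoi; [|exact: (pNP m).1|exact: (pNP m).2|exact: f0].
- by move=> m; apply: oma_optimal_aoi; [|exact: (pOP m).1|exact: (pOP m).2|exact: g0].
(* Numerator and denominator of e^(-1) / [throughput eta] are multiplied by 2 e^eta; the identity
   becomes rational in y = e^(eta / 2). *)
rewrite (_ : 2 * _ / _ = expR (- 1) / throughput eta); last first.
  have e1 : expR (eta - 1) = expR (- 1) * expR (eta / 2) * expR (eta / 2).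
    by rewrite -!expRD; congr expR; field.
  have e2 : expR (- (eta / 2)) = (expR (eta / 2))^-1 by rewrite expRN.
  have e3 : expR (- eta) = (expR (eta / 2))^-1 * (expR (eta / 2))^-1.
    by rewrite -!expRN -expRD; congr expR; field.
  rewrite /throughput e1 e2 e3; have := expR_gt0 (eta / 2).
  move: (expR (eta / 2)) => y y0; field.
  by rewrite !gt_eqF//; nra.
(* The limits [cf] and [cg] are indexed by m + 1 competitors, that is, M = m + 2 users. *)
rewrite -(cvg_shiftn 2) /=.
have := cvg_aoi_ratio T_gt0 phi0 (expR_gt0 (- 1)) f0 g0 cf cg.
move=> h; apply: cvg_trans h; apply: near_eq_cvg; apply: nearW => n.
by rewrite addn2.
Qed.
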